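(* Let $n=n_1+n_2$ with $n_1,n_2\ge1$, let $\mathbf{X}=(\mathbf{X}_1',\mathbf{X}_2')'$ be an $n$-dimensional random vector partitioned into $\mathbf{X}_1$ of dimension $n_1$ and $\mathbf{X}_2$ of dimension $n_2$, and let $\boldsymbol{\Delta}=(\boldsymbol{\Delta}_1',\boldsymbol{\Delta}_2')'$ be the corresponding partition of the $n\times m$ skewness matrix $\boldsymbol{\Delta}$, with $\boldsymbol{\Delta}_i$ of order $n_i\times m$. Suppose that one of the following holds: (i) $\mathbf{X}\sim CFUSN_{n,m}(\boldsymbol{\Delta})$, so that $\mathbf{X}_1\sim CFUSN_{n_1,m}(\boldsymbol{\Delta}_1)$ and $\mathbf{X}_2\sim CFUSN_{n_2,m}(\boldsymbol{\Delta}_2)$; in this case put $\mathbf{T}=\mathbf{X}$, $\mathbf{T}_1=\mathbf{X}_1$, $\mathbf{T}_2=\mathbf{X}_2$; (ii) $\mathbf{X}\sim LCFUSN_{n,m}(\boldsymbol{\Delta})$, so that $\mathbf{X}_1\sim LCFUSN_{n_1,m}(\boldsymbol{\Delta}_1)$ and $\mathbf{X}_2\sim LCFUSN_{n_2,m}(\boldsymbol{\Delta}_2)$; in this case put $\mathbf{T}=\ln\mathbf{X}$, $\mathbf{T}_1=\ln\mathbf{X}_1$, $\mathbf{T}_2=\ln\mathbf{X}_2$ (componentwise). Then the mutual information between $\mathbf{X}_1$ and $\mathbf{X}_2$ is $$I_{\mathbf{X}_1\mathbf{X}_2}=E\left[\ln\left(\frac{\Phi_m(\boldsymbol{\Delt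a}'\mathbf{T}\mid\mathbf{I}_m-\boldsymbol{\Delta}'\boldsymbol{\Delta})}{2^m\,\Phi_m(\boldsymbol{\Delta}_1'\mathbf{T}_1\mid\mathbf{I}_m-\boldsymbol{\Delta}_1'\boldsymbol{\Delta}_1)\,\Phi_m(\boldsymbol{\Delta}_2'\mathbf{T}_2\mid\mathbf{I}_m-\boldsymbol{\Delta}_2'\boldsymbol{\Delta}_2)}\right)\right].$$
   Context: For random vectors $\mathbf{X}_1,\mathbf{X}_2$ with joint density $f_{\mathbf{X}_1,\mathbf{X}_2}$ and marginal densities $f_{\mathbf{X}_1},f_{\mathbf{X}_2}$, the mutual information is the Kullback-Leibler divergence of the joint density from the product of the marginals: $$I_{\mathbf{X}_1\mathbf{X}_2}=E\left[\ln\frac{f_{\mathbf{X}_1,\mathbf{X}_2}(\mathbf{X}_1,\mathbf{X}_2)}{f_{\mathbf{X}_1}(\mathbf{X}_1)f_{\mathbf{X}_2}(\mathbf{X}_2)}\right].$$ Notation: a prime denotes transpose; $\phi_n$ is the density of $N_n(\mathbf{0},\mathbf{I}_n)$; $\Phi_m(\cdot\mid\mathbf{S})$ is the cumulative distribution function of $N_m(\mathbf{0},\mathbf{S})$; $\|\cdot\|$ is the Euclidean norm; $\exp$ and $\ln$ of vectors are taken componentwise. Let $n,m\ge1$ and let $\boldsymbol{\Delta}$ be a real $n\times m$ matrix (skewness matrix) with $\|\boldsymbol{\Delta}\mathbf{a}\|<1$ for all unit vectors $\mathbf{a}\in\mathbb{R}^m$. Canonical fundamental skew-normal distribution: $\mathbf{Z}\sim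 CFUSN_{n,m}(\boldsymbol{\Delta})$ means that $\mathbf{Z}$ has density $$f_{\mathbf{Z}}(\mathbf{z})=2^m\phi_n(\mathbf{z})\,\Phi_m(\boldsymbol{\Delta}'\mathbf{z}\mid\mathbf{I}_m-\boldsymbol{\Delta}'\boldsymbol{\Delta}),\quad\mathbf{z}\in\mathbb{R}^n.$$ Log-canonical fundamental skew-normal distribution: $\mathbf{Y}\sim LCFUSN_{n,m}(\boldsymbol{\Delta})$ means that $\ln\mathbf{Y}\sim CFUSN_{n,m}(\boldsymbol{\Delta})$; equivalently, $\mathbf{Y}$ has density $$f_{\mathbf{Y}}(\mathbf{y})=2^m\left(\prod_{i=1}^ny_i\right)^{-1}\phi_n(\ln\mathbf{y})\,\Phi_m(\boldsymbol{\Delta}'\ln\mathbf{y}\mid\mathbf{I}_m-\boldsymbol{\Delta}'\boldsymbol{\Delta}),\quad\mathbf{y}\in(0,\infty)^n.$$ Both families are closed under marginalization: subvectors have the distributions indicated in the claim. *)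

(* Defs.v *)
From HB Require Import structures.
From mathcomp Require Import all_boot all_order all_algebra.
From mathcomp Require Import all_classical all_reals all_analysis.

Set Implicit Arguments.
Unset Strict Implicit.
Unset Printing Implicit Defensive.

Import Order.TTheory GRing.Theory Num.Theory.
Import numFieldNormedType.Exports.

Local Open Scope classical_set_scope.
Local Open Scope ring_scope.

Definition measure_cV_display : measure_display -> measure_display.
Proof. exact. Qed.

(* Column vectors carry the sigma-algebra generated by the coordinates; over
   the reals this is the Borel sigma-algebra of R^n. *)
Section measurable_cV.
Context {d} {T : measurableType d}.
Variable n : nat.

Let coords : 'I_n -> 'cV[T]_n -> T := fun i x => x i ord0.

Let cV_set0 : g_sigma_preimage coords set0.
Proof. exact: sigma_algebra0. Qed.

Let cV_setC A : g_sigma_preimage coords A -> g_sigma_preimage coords (~` A).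
Proof. exact: sigma_algebraC. Qed.

Let cV_bigcup (F : (set 'cV[T]_n)^nat) :
  (forall i, g_sigma_preimage coords (F i)) ->
  g_sigma_preimage coords (\bigcup_i (F i)).
Proof. exact: sigma_algebra_bigcup. Qed.

HB.instance Definition _ := @isMeasurable.Build (measure_cV_display d)
  ('cV[T]_n) (g_sigma_preimage coords) cV_set0 cV_setC cV_bigcup.

End measurable_cV.

Lemma measurable_coord d (T : measurableType d) n (i : 'I_n) :
  measurable_fun [set: 'cV[T]_n] (fun x : 'cV[T]_n => x i ord0).
Proof.
move=> _ Y mY; rewrite setTI; apply: sub_sigma_algebra => /=.
rewrite -bigcup_seq/=; exists i => /=; first by rewrite mem_index_enum.
by exists Y => //; rewrite setTI.
Qed.

Lemma measurable_fun_cV d1 d2 (T1 : measurableType d1) (T2 : measurableType d2)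
    n (f : T1 -> 'cV[T2]_n) :
  (forall i, measurable_fun [set: T1] (fun x => f x i ord0)) ->
  measurable_fun [set: T1] f.
Proof.
move=> mf _ A mA.
suff : g_sigma_preimage (fun (i : 'I_n) (x : 'cV[T2]_n) => x i ord0) `<=`
    [set B | measurable ([set: T1] `&` f @^-1` B)] by exact.
apply: smallest_sub.
  split => /=.
  - by rewrite preimage_set0 setI0.
  - move=> B /=; rewrite setTI => mB.
    by rewrite setTD preimage_setC setTI; exact: measurableC.
  - move=> F mF; rewrite preimage_bigcup setI_bigcupr.
    exact: bigcup_measurable.
rewrite -bigcup_seq/= => B [i _ [C mC <-]] /=.
by rewrite setTI; exact: (mf i).
Qed.

Definition cons_cV {R : realType} n (p : measurableTypeR R * 'cV[R]_n) :
  'cV[R]_n.+1 := col_mx (const_mx p.1 : 'cV[R]_1) p.2.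

Lemma measurable_cons_cV (R : realType) n :
  measurable_fun [set: measurableTypeR R * 'cV[R]_n] (@cons_cV R n).
Proof.
apply: measurable_fun_cV => i; case: (splitP (i : 'I_(1 + n))) => j ij.
- rewrite (_ : (fun _ => _) = fst); first exact: measurable_fst.
  apply/funext => p; have -> : i = lshift n j :> 'I_(1 + n) by exact/val_inj.
  by rewrite /cons_cV (col_mxEu (const_mx p.1 : 'cV_1)) mxE.
- rewrite (_ : (fun _ => _) = (fun x : 'cV[R]_n => x j ord0) \o snd).
    by apply: measurableT_comp; [exact: measurable_coord|exact: measurable_snd].
  apply/funext => p; have -> : i = rshift 1 j :> 'I_(1 + n) by exact/val_inj.
  by rewrite /cons_cV (col_mxEd (const_mx p.1 : 'cV_1)).
Qed.

(* Lebesgue measure on R^n, as the n-fold product of the Lebesgue measure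
   on R. *)
Fixpoint lebesgue_cV {R : realType} (n : nat) : set 'cV[R]_n -> \bar R :=
  match n with
  | 0 => \d_(0 : 'cV[R]_0)
  | n'.+1 => pushforward ((@lebesgue_measure R) \x @lebesgue_cV R n')%E
      (@cons_cV R n')
  end.
Arguments lebesgue_cV {R} n.

Section lebesgue_cV_measure.
Context {R : realType}.

Let uncons_cV n (x : 'cV[R]_n.+1) : measurableTypeR R * 'cV[R]_n :=
  (x ord0 ord0, dsubmx (x : 'cV[R]_(1 + n))).

Let cons_cVK n : cancel (@cons_cV R n) (@uncons_cV n).
Proof.
case=> r x; rewrite /uncons_cV /cons_cV /=; congr pair; last by rewrite col_mxKd.
have -> : ord0 = lshift n (ord0 : 'I_1) :> 'I_(1 + n) by exact/val_inj.
by rewrite (col_mxEu (const_mx r : 'cV_1)) mxE.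
Qed.

Let measurable_uncons_cV n : measurable_fun setT (@uncons_cV n).
Proof.
apply/measurable_fun_pairP; split => /=; first exact: measurable_coord.
apply: measurable_fun_cV => i.
rewrite (_ : (fun _ => _) = fun x : 'cV[R]_n.+1 => x (rshift 1 i) ord0).
  exact: measurable_coord.
by apply/funext => x; rewrite /= mxE.
Qed.

Section step.
Variables (n : nat) (mu : {sigma_finite_measure set 'cV[R]_n -> \bar R}).

Let nu := ((@lebesgue_measure R) \x mu)%E.
Let nu' := pushforward nu (@cons_cV R n).

Let mcons : measurable_fun setT (@cons_cV R n).
Proof. exact: measurable_cons_cV. Qed.

Let nu'0 : nu' set0 = 0%E.
Proof. exact: (measure0 nu). Qed.

Let nu'_ge0 A : (0 <= nu' A)%E.
Proof. exact: (measure_ge0 nu). Qed.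

Let nu'_sigma_additive : semi_sigma_additive nu'.
Proof.
have mpre A : measurable A -> measurable (@cons_cV R n @^-1` A).
  by move=> mA; rewrite -[X in measurable X]setTI; exact: mcons.
move=> F mF tF mUF; rewrite /nu' /pushforward preimage_bigcup.
apply: (@measure_semi_sigma_additive _ _ _ nu).
- by move=> k; exact: mpre.
- apply/trivIsetP => /= i j _ _ ij; rewrite -preimage_setI.
  by move/trivIsetP : tF => /(_ _ _ _ _ ij) ->//; rewrite preimage_set0.
- by rewrite -preimage_bigcup; exact: mpre.
Qed.

HB.instance Definition _ := isMeasure.Build _ _ _ nu'
  nu'0 nu'_ge0 nu'_sigma_additive.

Let nu'_sigma_finite : sigma_finite setT nu'.
Proof.
have /sigma_finiteP[F [TF ndF Foo]] := sigma_finiteT (@lebesgue_measure R).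
have /sigma_finiteP[G [TG ndG Goo]] := sigma_finiteT mu.
have TFG : \bigcup_k (F k `*` G k) = setT.
  rewrite -setXTT TF TG predeqE => -[x y]; split.
    by move=> [k _ []/= ? ?]; split; exists k.
  move=> [/= [i _ Fix] [j _ Gjy]]; exists (maxn i j) => //; split.
  - by move: x Fix; exact/subsetPset/ndF/leq_maxl.
  - by move: y Gjy; exact/subsetPset/ndG/leq_maxr.
exists (fun k => @uncons_cV n @^-1` (F k `*` G k)).
  by rewrite -preimage_bigcup TFG preimage_setT.
move=> k; have [mFk Fkoo] := Foo k; have [mGk Gkoo] := Goo k; split.
  have mFG : measurable (F k `*` G k) by exact: measurableX.
  by rewrite -[X in measurable X]setTI; exact: measurable_uncons_cV.
rewrite /nu' /pushforward -comp_preimage.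
rewrite (_ : _ \o _ = idfun) ?preimage_id//.
  by rewrite /nu product_measure1E// lte_mul_pinfty// ge0_fin_numE.
by apply/funext => p /=; rewrite cons_cVK.
Qed.

HB.instance Definition _ := Measure_isSigmaFinite.Build _ _ _ nu'
  nu'_sigma_finite.

Lemma lebesgue_cV_step :
  exists mu' : {sigma_finite_measure set 'cV[R]_n.+1 -> \bar R},
    mu' = nu' :> (set 'cV[R]_n.+1 -> \bar R).
Proof. by exists nu'. Qed.

End step.

Let lebesgue_cV_sigma_finite_measure n :
  exists mu : {sigma_finite_measure set 'cV[R]_n -> \bar R},
    mu = lebesgue_cV n :> (set 'cV[R]_n -> \bar R).
Proof.
elim: n => [|n [mu muE]]; first by exists (\d_(0 : 'cV[R]_0)).
by have [mu' mu'E] := lebesgue_cV_step mu; exists mu'; rewrite mu'E /= -muE.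
Qed.

Variable n : nat.

Let lebesgue_cV0 : @lebesgue_cV R n set0 = 0%E.
Proof. by have [mu <-] := lebesgue_cV_sigma_finite_measure n. Qed.

Let lebesgue_cV_ge0 A : (0 <= @lebesgue_cV R n A)%E.
Proof. by have [mu <-] := lebesgue_cV_sigma_finite_measure n. Qed.

Let lebesgue_cV_sigma_additive : semi_sigma_additive (@lebesgue_cV R n).
Proof.
have [mu <-] := lebesgue_cV_sigma_finite_measure n.
exact: measure_semi_sigma_additive.
Qed.

HB.instance Definition _ := isMeasure.Build _ _ _ (@lebesgue_cV R n)
  lebesgue_cV0 lebesgue_cV_ge0 lebesgue_cV_sigma_additive.

Let lebesgue_cV_sigma_finite : sigma_finite setT (@lebesgue_cV R n).
Proof.
have [mu <-] := lebesgue_cV_sigma_finite_measure n; exact: sigma_finiteT.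
Qed.

HB.instance Definition _ := Measure_isSigmaFinite.Build _ _ _
  (@lebesgue_cV R n) lebesgue_cV_sigma_finite.

End lebesgue_cV_measure.

Definition ln_cV {R : realType} {n : nat} (x : 'cV[R]_n) : 'cV[R]_n :=
  map_mx (@ln R) x.

Section distributions.
Context {R : realType}.

(* The library's norm on matrices is the sup norm, hence this definition. *)
Definition enorm n (x : 'cV[R]_n) : R := Num.sqrt (\sum_i x i ord0 ^+ 2).

Definition skewness_matrix n m (D : 'M[R]_(n, m)) : Prop :=
  forall a : 'cV[R]_m, enorm a = 1 -> enorm (D *m a) < 1.

(* Density of N_n(0, S), for S symmetric positive definite. *)
Definition mvnormal_pdf n (S : 'M[R]_n) (x : 'cV[R]_n) : R :=
  (Num.sqrt ((2 * pi) ^+ n * \det S))^-1 *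
  expR (- (x^T *m invmx S *m x) ord0 ord0 / 2).

(* Phi_m(x | S) *)
Definition mvnormal_cdf m (S : 'M[R]_m) (x : 'cV[R]_m) : R :=
  \int[lebesgue_cV m]_(u in [set u | forall i, u i ord0 <= x i ord0])
    mvnormal_pdf S u.

Definition cfusn_pdf n m (D : 'M[R]_(n, m)) (z : 'cV[R]_n) : R :=
  2 ^+ m * mvnormal_pdf 1%:M z *
  mvnormal_cdf (1%:M - D^T *m D) (D^T *m z).

Context {d : measure_display} {Omega : measurableType d}
  (P : probability Omega R).

Definition has_density n (X : Omega -> 'cV[R]_n) (f : 'cV[R]_n -> R) : Prop :=
  [/\ measurable_fun setT X, measurable_fun setT f, forall x, 0 <= f x &
      forall A, measurable A ->
        P (X @^-1` A) = (\int[lebesgue_cV n]_(x in A) (f x)%:E)%E].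

Definition CFUSN n m (D : 'M[R]_(n, m)) (Z : Omega -> 'cV[R]_n) : Prop :=
  has_density Z (cfusn_pdf D).

(* Positivity is stated because the library's ln is 0 on the nonpositive
   reals. *)
Definition LCFUSN n m (D : 'M[R]_(n, m)) (Y : Omega -> 'cV[R]_n) : Prop :=
  {ae P, forall w, forall i, 0 < Y w i ord0} /\ CFUSN D (ln_cV \o Y).

(* f12, f1 and f2 are meant to be densities of (X1', X2')', X1 and X2; which
   versions are chosen does not matter. *)
Definition mutual_information n1 n2 (X1 : Omega -> 'cV[R]_n1)
    (X2 : Omega -> 'cV[R]_n2) (f12 : 'cV[R]_(n1 + n2) -> R)
    (f1 : 'cV[R]_n1 -> R) (f2 : 'cV[R]_n2 -> R) : \bar R :=
  'E_P[fun w => ln (f12 (col_mx (X1 w) (X2 w)) / (f1 (X1 w) * f2 (X2 w)))].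

End distributions.

(* Main.v *)
Require Import Defs.
From mathcomp Require Import all_boot all_order all_algebra.
From mathcomp Require Import all_classical all_reals all_analysis.
From mathcomp Require Import measurable_realfun ring.

Import Order.TTheory GRing.Theory Num.Theory.
Import numFieldNormedType.Exports.

Local Open Scope classical_set_scope.
Local Open Scope ring_scope.

(** A density is determined up to a null set, so almost surely [f12], [f1] and
[f2] may be replaced by any explicit densities of the joint law and of the two
marginals ([has_density_unique]). In case (i) these are the skew-normal
densities of [D], [usubmx D] and [dsubmx D]; the standard normal factor of the
joint density is the product of those of the marginals, it cancels in the
likelihood ratio, and of the powers of 2 only [2 ^ m] in the denominator
survives ([cfusn_pdf_ratio]).

The point to prove is that the marginals of a skew-normal vector are
skew-normal ([CFUSN_usubmx], [CFUSN_dsubmx]). Write [D1], [D2] for the blocks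
of [D] and [S = I - D'D], a prime denoting the transpose. The joint density is
[2^m phi(x) phi(y) Phi(D1'x + D2'y | S)], so integrating [y] out means
averaging [Phi(c + D2'y | S)] over a standard normal [y]. This average is the
probability that [U - D2'Y <= c] with [U ~ N(0, S)] independent of
[Y ~ N(0, I)]; the vector [U - D2'Y] is centred normal with covariance
[S + D2'D2 = I - D1'D1], whence [Phi(c | I - D1'D1)]
([integral_mvnormal_cdf_conv]). At the level of densities, the covariance of
the sum is obtained by adding one column of [D2'] at a time: each column is a
rank-one update of the covariance matrix and a one-dimensional Gaussian
integral, by completing the square ([std_normal_mvnormal_pdf],
[integral_mvnormal_pdf_conv]).

In case (ii) the componentwise substitution [y = exp t] turns the density of
[ln X] into that of [X], with the Jacobian factor [1 / prod_i y_i]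
([has_density_ln_cV]). The factors of the two blocks multiply to that of the
whole vector, so they cancel in the ratio and the computation of case (i)
applies to [ln X]. *)

Set Implicit Arguments.
Unset Strict Implicit.
Unset Printing Implicit Defensive.

(** * Measurability of vector operations *)

Section measurability.
Context {R : realType}.

Lemma measurable_cV0 d (T : measurableType d) (f : 'cV[R]_0 -> T) :
  measurable_fun setT f.
Proof.
have -> : f = cst (f 0) by apply/funext => x; rewrite [x]flatmx0.
exact: measurable_cst.
Qed.

Section comb.
Context d (T : measurableType d).

Lemma measurable_cV_coord n (f : T -> 'cV[R]_n) i :
  measurable_fun setT f -> measurable_fun setT (fun t => f t i ord0).
Proof. by move=> mf; apply: (measurableT_comp (measurable_coord i) mf). Qed.

Lemma measurable_forall (I : finType) (b : I -> T -> bool) :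
  (forall i, measurable_fun setT (b i)) ->
  measurable_fun setT (fun t => [forall i, b i t]).
Proof.
move=> mb.
rewrite (_ : (fun t => _) = fun t => \big[andb/true]_i b i t); last first.
  by apply/funext => t; rewrite big_andE.
elim: (index_enum I) => [|i s ih].
  by under eq_fun do rewrite big_nil; exact: measurable_cst.
under eq_fun do rewrite big_cons; exact: measurable_and.
Qed.

Lemma measurable_col_mx n1 n2 (f : T -> 'cV[R]_n1) (g : T -> 'cV[R]_n2) :
  measurable_fun setT f -> measurable_fun setT g ->
  measurable_fun setT (fun t => col_mx (f t) (g t)).
Proof.
move=> mf mg; apply: measurable_fun_cV => i; rewrite -[i]splitK.
case: (fintype.split i) => j /=.
- by under eq_fun do rewrite col_mxEu; exact: measurable_cV_coord.
- by under eq_fun do rewrite col_mxEd; exact: measurable_cV_coord.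
Qed.

Lemma measurable_usubmx n1 n2 (f : T -> 'cV[R]_(n1 + n2)) :
  measurable_fun setT f -> measurable_fun setT (fun t => usubmx (f t)).
Proof.
move=> mf; apply: measurable_fun_cV => i.
by under eq_fun do rewrite mxE; exact: measurable_cV_coord.
Qed.

Lemma measurable_dsubmx n1 n2 (f : T -> 'cV[R]_(n1 + n2)) :
  measurable_fun setT f -> measurable_fun setT (fun t => dsubmx (f t)).
Proof.
move=> mf; apply: measurable_fun_cV => i.
by under eq_fun do rewrite mxE; exact: measurable_cV_coord.
Qed.

Lemma measurable_addmx n (f g : T -> 'cV[R]_n) :
  measurable_fun setT f -> measurable_fun setT g ->
  measurable_fun setT (fun t => f t + g t).
Proof.
move=> mf mg; apply: measurable_fun_cV => i.
under eq_fun do rewrite mxE.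
by apply: measurable_funD; exact: measurable_cV_coord.
Qed.

Lemma measurable_mulmx n k (A : 'M[R]_(n, k)) (f : T -> 'cV[R]_k) :
  measurable_fun setT f -> measurable_fun setT (fun t => A *m f t).
Proof.
move=> mf; apply: measurable_fun_cV => i.
under eq_fun do rewrite mxE.
apply: measurable_sum => j; apply: measurable_funM => //.
exact: measurable_cV_coord.
Qed.

Lemma measurable_map_cV n (h : R -> R) (f : T -> 'cV[R]_n) :
  measurable_fun setT h ->
  measurable_fun setT f -> measurable_fun setT (fun t => map_mx h (f t)).
Proof.
move=> mh mf; apply: measurable_fun_cV => i.
under eq_fun do rewrite mxE.
by apply: (measurableT_comp mh); exact: measurable_cV_coord.
Qed.

Lemma measurable_mvnormal_pdf n (S : 'M[R]_n) (f : T -> 'cV[R]_n) :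
  measurable_fun setT f -> measurable_fun setT (fun t => mvnormal_pdf S (f t)).
Proof.
move=> mf; apply: measurable_funM => //; apply: measurableT_comp => //.
apply: measurable_funM => //; apply: measurable_funN.
under eq_fun do rewrite -mulmxA mxE.
apply: measurable_sum => j; apply: measurable_funM.
  by under eq_fun do rewrite mxE; exact: measurable_cV_coord.
by apply: measurable_cV_coord; exact: measurable_mulmx.
Qed.

End comb.
End measurability.

(** * Iterated integrals over column vectors *)

Section integral_cV.
Context {R : realType}.
Local Open Scope ereal_scope.
Local Notation leb := (@lebesgue_measure R).

Lemma integral_cV0 (f : 'cV[R]_0 -> \bar R) :
  \int[lebesgue_cV 0]_x f x = f 0%R.
Proof.
rewrite (_ : lebesgue_cV 0 = \d_(0%R : 'cV[R]_0)) // integral_dirac//.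
  by rewrite diracT mul1e.
exact: measurable_cV0.
Qed.

Lemma ge0_integral_cVS n (f : 'cV[R]_n.+1 -> \bar R) :
  measurable_fun setT f -> (forall x, 0 <= f x) ->
  \int[lebesgue_cV n.+1]_x f x =
  \int[leb]_r \int[lebesgue_cV n]_x f (cons_cV (r, x)).
Proof.
move=> mf f0.
transitivity (\int[pushforward (leb \x @lebesgue_cV R n) (@cons_cV R n)]_x f x).
  by [].
rewrite ge0_integral_pushforward//; last exact: measurable_cons_cV.
rewrite preimage_setT fubini_tonelli1//; last by move=> p; exact: f0.
by apply: measurableT_comp => //; exact: measurable_cons_cV.
Qed.

Lemma col_mx_cons n1 n2 (r : R) (x : 'cV[R]_n1) (y : 'cV[R]_n2) :
  col_mx (cons_cV (r, x)) y = cons_cV (r, col_mx x y).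
Proof.
rewrite /cons_cV /=.
have /= -> := @col_mxA _ 1 n1 n2 1 (const_mx r) x y.
apply/matrixP => i j.
by rewrite castmxE /= cast_ord_id; congr (_ _ _); exact/val_inj.
Qed.

Lemma measurable_fun_cons_cV d (T : measurableType d) n (f : T -> R)
    (g : T -> 'cV[R]_n) :
  measurable_fun setT f -> measurable_fun setT g ->
  measurable_fun setT (fun t => cons_cV (f t, g t)).
Proof.
move=> mf mg; apply: (@measurableT_comp _ _ _ _ _ _ (@cons_cV R n)).
  exact: measurable_cons_cV.
exact/measurable_fun_pairP.
Qed.

Lemma ge0_integral_col_mx n1 n2 (f : 'cV[R]_(n1 + n2) -> \bar R) :
  measurable_fun setT f -> (forall x, 0 <= f x) ->
  \int[lebesgue_cV (n1 + n2)]_x f x =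
  \int[lebesgue_cV n1]_x \int[lebesgue_cV n2]_y f (col_mx x y).
Proof.
elim: n1 f => [|n1 ih] f mf f0.
  rewrite integral_cV0; apply: eq_integral => x _.
  congr f; apply/matrixP => i j.
  transitivity (col_mx (0 : 'cV[R]_0) x (rshift 0 i) j).
    by rewrite col_mxEd.
  by congr (_ _ _); exact/val_inj.
rewrite (@ge0_integral_cVS (n1 + n2))// ge0_integral_cVS//; last 2 first.
- apply: (@measurable_fun_fubini_tonelli_F _ _ _ _ _ _
    (fun p : _ * 'cV[R]_n2 => f (col_mx p.1 p.2))) => //.
  apply: measurableT_comp => //; exact: measurable_col_mx.
- by move=> x; exact: integral_ge0.
apply: eq_integral => r _.
rewrite (ih (fun z => f (cons_cV (r, z)))) => [||z]; last 2 first.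
- by apply: measurableT_comp => //; exact: measurable_fun_cons_cV.
- exact: f0.
apply: eq_integral => x _; apply: eq_integral => y _.
by rewrite col_mx_cons.
Qed.

End integral_cV.

(** * Substitutions on the line *)

Section change_of_variables.
Context {R : realType}.
Local Open Scope ereal_scope.
Local Notation leb := (@lebesgue_measure R).

(** Both sides are measures in [A], and they agree on half-open intervals. *)
Lemma lebesgue_measure_affine (a b : R) (A : set R) :
  (0 < a)%R -> measurable A ->
  leb A = a%:E *
    leb ((fun x : measurableTypeR R => (b + a * x)%R : measurableTypeR R)
      @^-1` A).
Proof.
move=> a0 mA.
pose phi (x : measurableTypeR R) : measurableTypeR R := (b + a * x)%R.
have mphi : measurable_fun setT phi.
  by apply: measurable_funD => //; exact: measurable_funM.
(* Inference does not find the measurability proof of phi. *)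
pose pm :=
  measure_function_pushforward__canonical__measure_function_Measure leb mphi.
pose nu := mscale (NngNum (ltW a0)) pm.
rewrite (@lebesgue_measure_unique _ nu)// => _ [[u v]] _ <-.
rewrite /nu/= /mscale/= /pushforward.
have -> : phi @^-1` `]u, v]%classic =
    `]((u - b) / a)%R, ((v - b) / a)%R]%classic.
  apply/seteqP; split => x;
    rewrite /phi/= !in_itv/= ltr_pdivrMr// ler_pdivlMr//;
    by rewrite ltrBlDl lerBrDl mulrC.
rewrite !lebesgue_measure_itv/= !lte_fin ltr_pM2r ?invr_gt0// ltrD2r.
case: ifPn => _; last by rewrite mule0.
rewrite -!EFinD -EFinM; congr EFin.
by field; rewrite gt_eqF.
Qed.

Lemma ge0_integral_affine (a b : R) (f : R -> \bar R) :
  (0 < a)%R -> measurable_fun setT f -> (forall x, 0 <= f x) ->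
  \int[leb]_x f x = a%:E * \int[leb]_x f (b + a * x)%R.
Proof.
move=> a0 mf f0.
pose phi (x : measurableTypeR R) : measurableTypeR R := (b + a * x)%R.
have mphi : measurable_fun setT phi.
  by apply: measurable_funD => //; exact: measurable_funM.
(* Inference does not find the measurability proof of phi. *)
pose pm :=
  measure_function_pushforward__canonical__measure_function_Measure leb mphi.
pose nu := mscale (NngNum (ltW a0)) pm.
transitivity (\int[nu]_x f x).
  apply: eq_measure_integral => A mA _.
  by rewrite /nu/= /mscale/=; exact: lebesgue_measure_affine.
rewrite /nu ge0_integral_mscale//=; congr (_ * _).
by rewrite ge0_integral_pushforward// preimage_setT.
Qed.

Lemma integral_expRN :
  \int[leb]_s (if (0 <= s)%R then (expR (- s))%:E else 0) = 1.
Proof.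
rewrite -(@integral_exponential_pdf R 1%R ltr01).
apply: eq_integral => s _; rewrite /exponential_pdf patchE.
by rewrite mem_setE in_itv/= andbT mul1r mulN1r; case: ifP.
Qed.

(** [expR t] is the length of [0 < x <= expR t],
so the right-hand side is a double integral over [x] and [t]. For fixed [x], a
translation replaces [t] by [ln x + s] with [s >= 0]; for fixed [s], rescaling
[x] by [expR s] gives [expR (- s)] times the left-hand side; and [expR (- s)]
has integral 1 over [s >= 0]. *)
Lemma ge0_integral_expR (f : R -> \bar R) :
  measurable_fun setT f -> (forall x, 0 <= f x) ->
  \int[leb]_x (if (0 < x)%R then f x else 0) =
  \int[leb]_t (f (expR t) * (expR t)%:E).
Proof.
move=> mf f0; pose I := \int[leb]_x (if (0 < x)%R then f x else 0).
pose H (p : measurableTypeR R * measurableTypeR R) :=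
  if (0 < p.1)%R && (p.1 <= expR p.2)%R then f (expR p.2) else 0.
pose G (p : measurableTypeR R * measurableTypeR R) :=
  if (0 <= p.2)%R && (0 < p.1)%R then f (p.1 * expR p.2)%R else 0.
have mexp2 : measurable_fun setT
    (fun p : measurableTypeR R * measurableTypeR R => expR p.2).
  by apply: measurableT_comp => //; exact: measurable_snd.
have mmul : measurable_fun setT
    (fun p : measurableTypeR R * measurableTypeR R => (p.1 * expR p.2)%R).
  by apply: measurable_funM => //; exact: measurable_fst.
have mH : measurable_fun setT H.
  apply: measurable_fun_ifT => //; last exact: (measurableT_comp mf mexp2).
  apply: measurable_and.
    by apply: measurable_fun_ltr => //; exact: measurable_fst.
  by apply: measurable_fun_ler => //; exact: measurable_fst.
have mG : measurable_fun setT G.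
  apply: measurable_fun_ifT => //.
    apply: measurable_and.
      by apply: measurable_fun_ler => //; exact: measurable_snd.
    by apply: measurable_fun_ltr => //; exact: measurable_fst.
  exact: (measurableT_comp mf mmul).
have H0 p : 0 <= H p by rewrite /H; case: ifP.
have G0 p : 0 <= G p by rewrite /G; case: ifP.
have expE t : f (expR t) * (expR t)%:E = \int[leb]_x H (x, t).
  rewrite /H/=.
  transitivity (\int[leb]_x (f (expR t) * (\1_(`]0%R, (expR t)]) x)%:E)).
    rewrite ge0_integralZl//; last first.
      exact/measurable_EFinP/measurable_indic.
    rewrite integral_indic// setIT/= lebesgue_measure_itv/= lte_fin expR_gt0.
    by rewrite oppr0 adde0.
  apply: eq_integral => x _; rewrite indicE mem_setE in_itv/=.
  by case: ifP => _; rewrite ?mule1 ?mule0.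
have HG x : \int[leb]_t H (x, t) = \int[leb]_s G (x, s).
  rewrite /H /G/=; have [x0|x0] := ltP 0%R x; last first.
    by rewrite !integral0_eq// => s _; rewrite ?andbF.
  rewrite (@ge0_integral_affine 1%R (ln x))//; last 2 first.
  - apply: measurable_fun_ifT => //.
      by apply: measurable_fun_ler.
    by apply: measurableT_comp.
  - by move=> t; case: ifP.
  rewrite mul1e; apply: eq_integral => s _.
  by rewrite mul1r expRD lnK ?posrE// ler_pMr// -expR0 ler_expR andbT.
have GI s : \int[leb]_x G (x, s) =
    (if (0 <= s)%R then (expR (- s))%:E else 0) * I.
  rewrite /G/=; case: ifP => _ /=; last by rewrite mul0e integral0.
  rewrite /I (@ge0_integral_affine (expR s) 0%R _ (expR_gt0 s))//; last 2 first.
  - by apply: measurable_fun_ifT => //; apply: measurable_fun_ltr.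
  - by move=> x; case: ifP.
  rewrite muleA -EFinM -expRD addNr expR0 mul1e.
  apply: eq_integral => x _.
  by rewrite add0r pmulr_rgt0 ?expR_gt0// [(x * _)%R]mulrC.
transitivity (\int[leb]_t \int[leb]_x H (x, t)); last first.
  by apply: eq_integral => t _; rewrite expE.
transitivity (\int[leb]_x \int[leb]_t H (x, t)); last first.
  exact: fubini_tonelli.
transitivity (\int[leb]_x \int[leb]_s G (x, s)); last first.
  by apply: eq_integral => x _; rewrite HG.
transitivity (\int[leb]_s \int[leb]_x G (x, s)); last first.
  exact/esym/fubini_tonelli.
transitivity (\int[leb]_s ((if (0 <= s)%R then (expR (- s))%:E else 0) * I));
    last first.
  by apply: eq_integral => s _; rewrite GI.
rewrite ge0_integralZr//=; last 3 first.
- apply: measurable_fun_ifT => //; first by apply: measurable_fun_ler.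
  by apply/measurable_EFinP; apply: measurableT_comp => //.
- by move=> s _; case: ifP => _ //; rewrite lee_fin expR_ge0.
- by apply: integral_ge0 => x _; case: ifP.
by rewrite integral_expRN mul1e.
Qed.

End change_of_variables.

(** * Translations and the componentwise exponential *)

Section change_of_variables_cV.
Context {R : realType}.
Local Open Scope ereal_scope.
Local Notation leb := (@lebesgue_measure R).

Lemma cons_cV_ord0 n (r : R) (x : 'cV[R]_n) j : cons_cV (r, x) ord0 j = r.
Proof.
rewrite /cons_cV/=.
transitivity (@col_mx _ 1 n 1 (const_mx r) x (lshift n ord0) j).
  by congr (_ _ _); exact/val_inj.
by rewrite (col_mxEu (const_mx r : 'cV_1)) mxE.
Qed.

Lemma cons_cV_lift n (r : R) (x : 'cV[R]_n) i j :
  cons_cV (r, x) (lift ord0 i) j = x i j.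
Proof.
rewrite /cons_cV/=.
transitivity (@col_mx _ 1 n 1 (const_mx r) x (rshift 1 i) j).
  by congr (_ _ _); exact/val_inj.
by rewrite (col_mxEd (const_mx r : 'cV_1)).
Qed.

Definition cons_cVE := (cons_cV_ord0, cons_cV_lift).

Lemma cons_cV_surj n (v : 'cV[R]_n.+1) : exists r x, v = cons_cV (r, x).
Proof.
exists (v ord0 ord0), (\col_i v (lift ord0 i) ord0).
apply/colP => i.
by case: (unliftP ord0 i) => [k|] ->; rewrite cons_cVE ?mxE.
Qed.

Lemma measurable_integral_cV n d (T : measurableType d)
    (f : T -> 'cV[R]_n -> \bar R) :
  measurable_fun setT (fun p => f p.1 p.2) -> (forall t x, 0 <= f t x) ->
  measurable_fun setT (fun t => \int[lebesgue_cV n]_x f t x).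
Proof.
move=> mf f0.
exact: (@measurable_fun_fubini_tonelli_F _ _ _ _ _ _ (fun p => f p.1 p.2)).
Qed.

(** By induction on the dimension, translating one coordinate at a time. *)
Lemma ge0_integral_cV_shift n (v : 'cV[R]_n) (f : 'cV[R]_n -> \bar R) :
  measurable_fun setT f -> (forall x, 0 <= f x) ->
  \int[lebesgue_cV n]_x f x = \int[lebesgue_cV n]_x f (v + x)%R.
Proof.
elim: n v f => [|n ih] v f mf f0.
  by rewrite !integral_cV0; congr f; apply/colP; case.
have [c [w ->]] := cons_cV_surj v.
have mfs : measurable_fun setT (fun x => f (cons_cV (c, w) + x)%R).
  by apply: measurableT_comp => //; exact: measurable_addmx.
rewrite [LHS](ge0_integral_cVS mf f0) [RHS](ge0_integral_cVS mfs) => [|x];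
  last exact: f0.
have mg : measurable_fun setT
    (fun r => \int[lebesgue_cV n]_x f (cons_cV (r, x))).
  apply: measurable_integral_cV => //.
  apply: (measurableT_comp mf); apply: measurable_fun_cons_cV.
    exact: measurable_fst.
  exact: measurable_snd.
rewrite (@ge0_integral_affine _ 1%R c _ ltr01 mg) ?mul1e => [|r]; last first.
  exact: integral_ge0.
apply: eq_integral => r _.
rewrite (ih w (fun x => f (cons_cV (_, x)))) => [||x]; last 2 first.
- by apply: (measurableT_comp mf); exact: measurable_fun_cons_cV.
- exact: f0.
apply: eq_integral => x _; congr f; apply/colP => i.
by case: (unliftP ord0 i) => [k|] ->;
  rewrite cons_cVE [RHS]mxE !cons_cVE ?mxE ?mul1r.
Qed.

Lemma forall_ord_recl n (p : pred 'I_n.+1) :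
  [forall i, p i] = p ord0 && [forall i, p (lift ord0 i)].
Proof.
apply/forallP/andP => [p_|[p0 /forallP p_] i].
  by split=> //; apply/forallP.
by case: (unliftP ord0 i) => [k|] ->.
Qed.

Definition exp_cV n (t : 'cV[R]_n) : 'cV[R]_n := map_mx expR t.

Definition pos_cV n (x : 'cV[R]_n) : bool := [forall i, (0 < x i ord0)%R].

Lemma pos_cons_cV n (r : R) (x : 'cV[R]_n) :
  pos_cV (cons_cV (r, x)) = (0 < r)%R && pos_cV x.
Proof.
rewrite /pos_cV forall_ord_recl cons_cVE; congr andb.
by apply: eq_forallb => i; rewrite cons_cVE.
Qed.

Lemma measurable_pos_cV n : measurable_fun setT (@pos_cV n).
Proof.
apply: measurable_forall => i; apply: measurable_fun_ltr => //.
exact: measurable_coord.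
Qed.

(** The substitution [x = exp_cV t], one coordinate at a time; the product of
exponentials is the Jacobian determinant. *)
Lemma ge0_integral_cV_expR n (f : 'cV[R]_n -> \bar R) :
  measurable_fun setT f -> (forall x, 0 <= f x) ->
  \int[lebesgue_cV n]_x (if pos_cV x then f x else 0) =
  \int[lebesgue_cV n]_t (f (exp_cV t) * (\prod_i expR (t i ord0))%:E).
Proof.
elim: n f => [|n ih] f mf f0.
  rewrite !integral_cV0 big_ord0 mule1 ifT; first by congr f; rewrite flatmx0.
  by apply/forallP => -[].
have mJ k : measurable_fun setT
    (fun t : 'cV[R]_k => (\prod_i expR (t i ord0))%:E).
  apply/measurable_EFinP; apply: measurable_prod => i _.
  by apply: measurableT_comp => //; exact: measurable_coord.
have J0 k (t : 'cV[R]_k) : 0 <= (\prod_i expR (t i ord0))%:E.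
  by rewrite lee_fin; apply: prodr_ge0 => i _; exact: expR_ge0.
have mfe : measurable_fun setT (fun t => f (exp_cV t)).
  by apply: (measurableT_comp mf); exact: measurable_map_cV.
have mp : measurable_fun setT (fun x => if pos_cV x then f x else 0).
  by apply: measurable_fun_ifT => //; exact: measurable_pos_cV.
have mr : measurable_fun setT
    (fun t => f (exp_cV t) * (\prod_i expR (t i ord0))%:E).
  by apply: emeasurable_funM; [exact: mfe|exact: mJ].
rewrite [LHS](ge0_integral_cVS mp) => [|x]; last by case: ifP.
rewrite [RHS](ge0_integral_cVS mr) => [|t]; last by rewrite mule_ge0.
pose g r := \int[lebesgue_cV n]_t
  (f (cons_cV (r, exp_cV t)) * (\prod_i expR (t i ord0))%:E).
have g0 r : 0 <= g r by apply: integral_ge0 => t _; rewrite mule_ge0.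
have mg : measurable_fun setT g.
  apply: measurable_integral_cV => [|r t]; last by rewrite mule_ge0.
  apply: emeasurable_funM; last first.
    exact: (measurableT_comp (mJ n) measurable_snd).
  apply: (measurableT_comp mf) => /=.
  apply: measurable_fun_cons_cV; first exact: measurable_fst.
  by apply: measurable_map_cV => //; exact: measurable_snd.
transitivity (\int[leb]_r (if (0 < r)%R then g r else 0)).
  apply: eq_integral => r _; have [r0|r0] := ltP 0%R r; last first.
    by apply: integral0_eq => x _; rewrite pos_cons_cV ltNge r0.
  rewrite /g -(ih (fun x => f (cons_cV (r, x)))) => [||x]; last 2 first.
  - by apply: (measurableT_comp mf); exact: measurable_fun_cons_cV.
  - exact: f0.
  by apply: eq_integral => x _; rewrite pos_cons_cV r0.
rewrite ge0_integral_expR//; apply: eq_integral => s _.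
rewrite /g -ge0_integralZr//=; last 2 first.
- apply: emeasurable_funM; last exact: mJ.
  apply: (measurableT_comp mf).
  by apply: measurable_fun_cons_cV => //; exact: measurable_map_cV.
- by move=> t _; apply: mule_ge0; [exact: f0|exact: J0].
apply: eq_integral => t _; rewrite -muleA -EFinM; congr (_ * _).
  congr f; apply/colP => i.
  by case: (unliftP ord0 i) => [k|] ->; rewrite cons_cVE [RHS]mxE cons_cVE ?mxE.
rewrite big_ord_recl cons_cVE mulrC; congr (_ * _)%:E.
by apply: eq_bigr => i _; rewrite cons_cVE.
Qed.

End change_of_variables_cV.

(** * Rank-one updates of positive definite matrices *)

Section positive_definite.
Context {R : realType}.

Definition qform n (S : 'M[R]_n) (x : 'cV[R]_n) : R :=
  (x^T *m S *m x) ord0 ord0.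

Definition posdef n (S : 'M[R]_n) : Prop :=
  S^T = S /\ forall x, x != 0 -> 0 < qform S x.

Lemma posdef_ge0 n (S : 'M[R]_n) x : posdef S -> 0 <= qform S x.
Proof.
move=> [_ S0]; have [->|/S0/ltW//] := eqVneq x 0.
by rewrite /qform mulmx0 mxE.
Qed.

Lemma posdef_unit n (S : 'M[R]_n) : posdef S -> S \in unitmx.
Proof.
move=> [_ S0]; rewrite unitmxE unitfE; apply/negP => /det0P[v v0 vS].
have /S0 : v^T != 0 by rewrite trmx_eq0.
by rewrite /qform trmxK vS mul0mx mxE ltxx.
Qed.

Lemma qform_invmx n (S : 'M[R]_n) b : posdef S ->
  qform (invmx S) b = qform S (invmx S *m b).
Proof.
move=> S0; have uS := posdef_unit S0; rewrite /qform trmx_mul.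
by rewrite trmx_inv S0.1 -!mulmxA [S *m _]mulmxA mulmxV// mul1mx.
Qed.

Lemma qform_invmx_ge0 n (S : 'M[R]_n) b : posdef S -> 0 <= qform (invmx S) b.
Proof. by move=> S0; rewrite qform_invmx// posdef_ge0. Qed.

(** [x' B B' x] is the sum of the squares of the entries of [B' x]. *)
Lemma posdef_add_gram n k (S : 'M[R]_n) (B : 'M[R]_(n, k)) :
  posdef S -> posdef (S + B *m B^T).
Proof.
move=> [ST S0]; split; first by rewrite linearD/= ST trmx_mul trmxK.
move=> x /S0 x0; rewrite /qform mulmxDr mulmxDl mxE ltr_wpDr//.
rewrite mulmxA -mulmxA (_ : x^T *m B = (B^T *m x)^T); last first.
  by rewrite trmx_mul trmxK.
by rewrite mxE; apply: sumr_ge0 => i _; rewrite [X in X * _]mxE -expr2 sqr_ge0.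
Qed.

(** The matrix determinant lemma: the bordered matrix [M] of the proof has two
triangular factorizations, whose determinants are [\det (1 + u b')] and
[1 + b' u]. *)
Lemma det_add_rank1 n (S : 'M[R]_n) (b : 'cV[R]_n) : S \in unitmx ->
  \det (S + b *m b^T) = \det S * (1 + qform (invmx S) b).
Proof.
move=> uS; pose u := invmx S *m b.
have -> : S + b *m b^T = S *m (1%:M + u *m b^T).
  by rewrite mulmxDr mulmx1 /u !mulmxA mulmxV// mul1mx.
rewrite det_mulmx; congr (_ * _).
pose M := block_mx 1%:M (- u) b^T (1%:M : 'M[R]_1).
transitivity (\det M).
  have -> : M = block_mx 1%:M (- u) 0 1%:M *m
                block_mx (1%:M + u *m b^T) 0 b^T 1%:M.
    rewrite mulmx_block !(mul1mx, mulmx1, mul0mx, mulmx0, add0r) mulNmx addrK.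
    by rewrite /M.
  by rewrite det_mulmx det_ublock det_lblock !det1 !mul1r mulr1.
have -> : M = block_mx 1%:M 0 b^T 1%:M *m
              block_mx 1%:M (- u) 0 (1%:M + b^T *m u).
  rewrite mulmx_block !(mul1mx, mulmx1, mul0mx, mulmx0, addr0) mulmxN.
  by rewrite addrC addrK.
rewrite det_mulmx det_lblock det_ublock !det1 !mul1r.
by rewrite det_mx11 mxE [X in X + _]mxE eqxx /qform /u mulmxA.
Qed.

(** The Sherman-Morrison formula, tested on [v]: the vector [w] of the proof
solves [(S + b b') w = v]. *)
Lemma qform_inv_add_rank1 n (S : 'M[R]_n) (b v : 'cV[R]_n) : posdef S ->
  qform (invmx (S + b *m b^T)) v =
  qform (invmx S) v -
  (b^T *m invmx S *m v) ord0 ord0 ^+ 2 / (1 + qform (invmx S) b).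
Proof.
move=> S0; have uS := posdef_unit S0.
have uS' := posdef_unit (posdef_add_gram b S0).
set c := qform (invmx S) b; set beta := (b^T *m invmx S *m v) ord0 ord0.
have c1 : 1 + c != 0 by rewrite gt_eqF// ltr_wpDr// qform_invmx_ge0.
have bv : b^T *m (invmx S *m v) = beta%:M by rewrite mulmxA [LHS]mx11_scalar.
have bb : b^T *m (invmx S *m b) = c%:M by rewrite mulmxA [LHS]mx11_scalar.
have vb : v^T *m (invmx S *m b) = beta%:M.
  apply: trmx_inj; rewrite tr_scalar_mx -bv !trmx_mul trmxK trmx_inv S0.1.
  by rewrite mulmxA.
pose w := invmx S *m v - (beta / (1 + c)) *: (invmx S *m b).
have Sw : (S + b *m b^T) *m w = v.
  rewrite /w mulmxDl !mulmxBr -!scalemxAr !mulmxA mulmxV// !mul1mx.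
  rewrite -!(mulmxA b) -!(mulmxA b^T) bv bb !mul_mx_scalar scalerA.
  rewrite -scalerBl addrAC -addrA -[RHS]addr0; congr (_ + _).
  rewrite -scalerBl; apply/eqP; rewrite scaler_eq0; apply/orP; left.
  by apply/eqP; field.
have -> : qform (invmx (S + b *m b^T)) v = (v^T *m w) ord0 ord0.
  by rewrite /qform -{2}Sw -!mulmxA mulKmx.
rewrite /w mulmxBr -scalemxAr vb /qform mulmxA mxE; congr (_ + _).
by rewrite mxE mxE mxE eqxx mulr1n -/beta expr2 mulrAC.
Qed.

End positive_definite.

(** * Sums of independent Gaussian vectors *)

Section gaussian_convolution.
Context {R : realType}.
Local Notation leb := (@lebesgue_measure R).

Definition std_normal (r : R) : R :=
  (Num.sqrt (2 * pi))^-1 * expR (- r ^+ 2 / 2).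

Lemma std_normal_ge0 r : 0 <= std_normal r.
Proof. by rewrite mulr_ge0 ?expR_ge0// invr_ge0 sqrtr_ge0. Qed.

Lemma mvnormal_pdf_ge0 n (S : 'M[R]_n) x : 0 <= mvnormal_pdf S x.
Proof. by rewrite mulr_ge0 ?expR_ge0// invr_ge0 sqrtr_ge0. Qed.

Lemma mvnormal_pdf0 (S : 'M[R]_0) x : mvnormal_pdf S x = 1.
Proof.
rewrite /mvnormal_pdf det_mx00 expr0 mulr1 sqrtr1 invr1 mul1r.
by rewrite [x]flatmx0 mulmx0 mxE oppr0 mul0r expR0.
Qed.

Lemma qform1 n (x : 'cV[R]_n) :
  (x^T *m invmx 1%:M *m x) ord0 ord0 = \sum_i x i ord0 ^+ 2.
Proof.
by rewrite invmx1 mulmx1 mxE; apply: eq_bigr => i _; rewrite mxE expr2.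
Qed.

(** The factorization on which every splitting of the standard normal density
into blocks rests. *)
Lemma mvnormal_pdf1 n (x : 'cV[R]_n) :
  mvnormal_pdf 1%:M x = \prod_i std_normal (x i ord0).
Proof.
rewrite /mvnormal_pdf /std_normal qform1 det1 mulr1 big_split/=.
rewrite prodr_const card_ord.
congr (_ * _).
  rewrite exprVn; congr (_^-1); elim: n {x} => [|n ih].
    by rewrite !expr0 sqrtr1.
  by rewrite !exprS sqrtrM ?ih// mulr_ge0// pi_ge0.
rewrite -expR_sum; congr expR.
by rewrite -mulr_suml -sumrN.
Qed.

Lemma mvnormal_pdf1_cons n r (x : 'cV[R]_n) :
  mvnormal_pdf 1%:M (cons_cV (r, x)) = std_normal r * mvnormal_pdf 1%:M x.
Proof.
rewrite !mvnormal_pdf1 big_ord_recl cons_cVE; congr (_ * _).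
by apply: eq_bigr => i _; rewrite cons_cVE.
Qed.

Lemma mvnormal_pdf1_col_mx n1 n2 (x : 'cV[R]_n1) (y : 'cV[R]_n2) :
  mvnormal_pdf 1%:M (col_mx x y) = mvnormal_pdf 1%:M x * mvnormal_pdf 1%:M y.
Proof.
rewrite !mvnormal_pdf1 big_split_ord/=; congr (_ * _); apply: eq_bigr => i _.
  by rewrite col_mxEu.
by rewrite col_mxEd.
Qed.

Lemma mvnormal_pdf1_gt0 n (x : 'cV[R]_n) : 0 < mvnormal_pdf 1%:M x.
Proof.
rewrite mvnormal_pdf1; apply: prodr_gt0 => i _.
by rewrite mulr_gt0 ?expR_gt0// invr_gt0 sqrtr_gt0 mulr_gt0// pi_gt0.
Qed.

(** Completing the square in [r]. With [beta = b' S^-1 v], the exponent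
[r^2 + (v + r b)' S^-1 (v + r b)] equals
[c (r + beta / c)^2 + v' S^-1 v - beta^2 / c]. The last two terms form the
quadratic form of [(S + b b')^-1] at [v], and [c = \det (S + b b') / \det S]
accounts for the normalizing constants. *)
Lemma std_normal_mvnormal_pdf n (S : 'M[R]_n) (b v : 'cV[R]_n) : posdef S ->
  let c := 1 + qform (invmx S) b in
  forall r, std_normal r * mvnormal_pdf S (v + r *: b) =
  mvnormal_pdf (S + b *m b^T) v *
  normal_pdf (- (b^T *m invmx S *m v) ord0 ord0 / c) (Num.sqrt c)^-1 r.
Proof.
move=> S0 c r; set beta := (b^T *m invmx S *m v) ord0 ord0.
have uS := posdef_unit S0.
have c0 : 0 < c by rewrite ltr_wpDr// qform_invmx_ge0.
have vb : (v^T *m invmx S *m b) ord0 ord0 = beta.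
  transitivity ((v^T *m invmx S *m b)^T ord0 ord0); first by rewrite [RHS]mxE.
  by rewrite !trmx_mul trmxK trmx_inv S0.1 mulmxA.
have qE : qform (invmx S) (v + r *: b) =
    qform (invmx S) v + 2 * r * beta + r ^+ 2 * (c - 1).
  have e1 : v^T *m invmx S *m b = beta%:M by rewrite [LHS]mx11_scalar vb.
  have e2 : b^T *m invmx S *m v = beta%:M by rewrite [LHS]mx11_scalar.
  have e3 : v^T *m invmx S *m v = (qform (invmx S) v)%:M.
    by rewrite [LHS]mx11_scalar.
  have e4 : b^T *m invmx S *m b = (c - 1)%:M.
    by rewrite [LHS]mx11_scalar /c addrC addKr.
  have tE : (v + r *: b)^T = v^T + r *: b^T.
    by apply/matrixP => i j; rewrite !mxE.
  rewrite [LHS]/qform tE !mulmxDl !mulmxDr -!scalemxAl -!scalemxAr.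
  by rewrite e1 e2 e3 e4 !mxE !eqxx !mulr1n; ring.
have sc0 : Num.sqrt c != 0 by rewrite gt_eqF// sqrtr_gt0.
rewrite normal_pdfE ?invr_eq0// /normal_peak /normal_fun.
rewrite /std_normal /mvnormal_pdf.
rewrite det_add_rank1// -/c exprVn sqr_sqrtr ?ltW//.
rewrite -!/(qform _ _) qform_inv_add_rank1// -/beta -/c qE.
have -> : Num.sqrt ((2 * pi) ^+ n * (\det S * c)) =
    Num.sqrt c * Num.sqrt ((2 * pi) ^+ n * \det S).
  by rewrite mulrA mulrC sqrtrM// ltW.
have -> : Num.sqrt (c^-1 * pi *+ 2) = (Num.sqrt c)^-1 * Num.sqrt (2 * pi) :> R.
  rewrite -mulrnAr -mulr_natl sqrtrM ?invr_ge0 ?ltW//.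
  by rewrite sqrtrV// ltW.
rewrite !invfM invrK.
set iA := (Num.sqrt ((2 * pi) ^+ n * \det S))^-1.
set i2 := (Num.sqrt (2 * pi))^-1.
rewrite mulrACA -expRD [RHS]mulrACA -expRD; congr (_ * expR _).
  by rewrite [RHS]mulrACA mulVf// mul1r mulrC.
by field; rewrite gt_eqF.
Qed.

Local Open Scope ereal_scope.

Lemma integral_std_normal_mvnormal_pdf n (S : 'M[R]_n) (b v : 'cV[R]_n) :
  posdef S ->
  \int[leb]_r (std_normal r * mvnormal_pdf S (v + r *: b))%:E =
  (mvnormal_pdf (S + b *m b^T) v)%:E.
Proof.
move=> S0; under eq_integral do rewrite std_normal_mvnormal_pdf// EFinM.
rewrite ge0_integralZl//=; last 3 first.
- by apply/measurable_EFinP; exact: measurable_normal_pdf.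
- by move=> r _; rewrite lee_fin normal_pdf_ge0.
- by rewrite lee_fin mvnormal_pdf_ge0.
by rewrite integral_normal_pdf mule1.
Qed.

Lemma measurable_mvnormal_pdf2 d (T : measurableType d) k n (S : 'M[R]_n)
    (x : T -> 'cV[R]_k) (y : T -> 'cV[R]_n) :
  measurable_fun setT x -> measurable_fun setT y ->
  measurable_fun setT
    (fun t => (mvnormal_pdf 1%:M (x t) * mvnormal_pdf S (y t))%:E).
Proof.
by move=> mx my; apply/measurable_EFinP; apply: measurable_funM;
  exact: measurable_mvnormal_pdf.
Qed.

Lemma mvnormal_pdf2_ge0 k n (S : 'M[R]_n) (x : 'cV[R]_k) y :
  0 <= (mvnormal_pdf 1%:M x * mvnormal_pdf S y)%:E.
Proof. by rewrite lee_fin mulr_ge0// mvnormal_pdf_ge0. Qed.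

(** The density of [N(0, S) - B X], for [X] standard normal and independent, is
that of [N(0, S + B B')]; the columns of [B] are integrated out one by one. *)
Lemma integral_mvnormal_pdf_conv k n (S : 'M[R]_n) (B : 'M[R]_(n, k)) v :
  posdef S ->
  \int[lebesgue_cV k]_x (mvnormal_pdf 1%:M x * mvnormal_pdf S (v + B *m x))%:E =
  (mvnormal_pdf (S + B *m B^T) v)%:E.
Proof.
elim: k B v => [|k ih] B v S0.
  rewrite integral_cV0 mvnormal_pdf0 mul1r mulmx0 addr0.
  by rewrite [B]thinmx0 mul0mx addr0.
pose b : 'cV[R]_n := @lsubmx _ n 1 k B.
pose C : 'M[R]_(n, k) := @rsubmx _ n 1 k B.
have BE : B = row_mx b C :> 'M[R]_(n, 1 + k) by rewrite hsubmxK.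
have BBT : (B *m B^T = C *m C^T + b *m b^T)%R.
  transitivity (row_mx b C *m (row_mx b C)^T); first by rewrite -BE.
  by rewrite tr_row_mx mul_row_col addrC.
have Bcons r x : (B *m cons_cV (r, x) = r *: b + C *m x)%R.
  transitivity (row_mx b C *m col_mx (const_mx r : 'cV_1) x).
    by rewrite -BE.
  rewrite mul_row_col; congr (_ + _)%R.
  apply/colP => i; rewrite [LHS]mxE [RHS]mxE big_ord1 [X in (_ * X)%R]mxE mulrC.
  by congr (_ * b _ _)%R; rewrite [RHS]ord1.
have mv j (A : 'M[R]_(n, j)) :
    measurable_fun setT (fun x : 'cV[R]_j => (v + A *m x)%R).
  by apply: measurable_addmx => //; exact: measurable_mulmx.
rewrite ge0_integral_cVS; last 2 first.
- by apply: (@measurable_mvnormal_pdf2 _ _ _ _ _ id) => //; exact: mv.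
- by move=> x; exact: mvnormal_pdf2_ge0.
rewrite BBT addrA -integral_std_normal_mvnormal_pdf; last first.
  exact: posdef_add_gram.
apply: eq_integral => r _.
rewrite EFinM -ih// -ge0_integralZl//=; last 3 first.
- apply: (@measurable_mvnormal_pdf2 _ _ _ _ _ id) => //.
  by apply: measurable_addmx => //; exact: measurable_mulmx.
- by move=> x _; exact: mvnormal_pdf2_ge0.
- by rewrite lee_fin std_normal_ge0.
apply: eq_integral => x _.
by rewrite mvnormal_pdf1_cons Bcons -EFinM -mulrA addrA.
Qed.

(** In dimension 0 the normal density is the constant 1, so the convolution
formula with [n = 0] is the normalization of the standard normal density. *)
Lemma integral_mvnormal_pdf1 k :
  \int[lebesgue_cV k]_x (mvnormal_pdf 1%:M x : R)%:E = 1.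
Proof.
have S0 : posdef (0 : 'M[R]_0).
  by split=> [|x]; [rewrite trmx0|rewrite [x]flatmx0 eqxx].
have := @integral_mvnormal_pdf_conv k 0 0 0 0 S0.
rewrite mvnormal_pdf0 => <-; apply: eq_integral => x _.
by rewrite mvnormal_pdf0 mulr1.
Qed.

(** Integrating the convolution formula over [v] and exchanging the integrals
gives the total mass of [S] on one side, by translation invariance, and that of
the standard normal density on the other. The covariance
matrix [I - D'D] is completed to the identity with [B = D']. *)
Lemma integral_mvnormal_pdf k n (S : 'M[R]_n) (B : 'M[R]_(n, k)) :
  posdef S -> (S + B *m B^T = 1%:M)%R ->
  \int[lebesgue_cV n]_x (mvnormal_pdf S x)%:E = 1.
Proof.
move=> S0 SB; pose H (p : 'cV[R]_n * 'cV[R]_k) :=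
  (mvnormal_pdf 1%:M p.2 * mvnormal_pdf S (p.1 + B *m p.2))%:E.
have mH : measurable_fun setT H.
  apply: measurable_mvnormal_pdf2; first exact: measurable_snd.
  apply: measurable_addmx; first exact: measurable_fst.
  by apply: measurable_mulmx; exact: measurable_snd.
have H0 p : 0 <= H p by exact: mvnormal_pdf2_ge0.
rewrite -(integral_mvnormal_pdf1 n) -SB.
transitivity (\int[lebesgue_cV n]_v \int[lebesgue_cV k]_x H (v, x)); last first.
  by apply: eq_integral => v _; rewrite /H/= integral_mvnormal_pdf_conv.
transitivity (\int[lebesgue_cV k]_x \int[lebesgue_cV n]_v H (v, x)); last first.
  exact/esym/fubini_tonelli.
set M := LHS.
have M0 : 0 <= M.
  by apply: integral_ge0 => x _; rewrite lee_fin mvnormal_pdf_ge0.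
have mS : measurable_fun setT (fun x => (mvnormal_pdf S x)%:E).
  by apply/measurable_EFinP; exact: measurable_mvnormal_pdf.
transitivity (\int[lebesgue_cV k]_x ((mvnormal_pdf 1%:M x)%:E * M)).
  rewrite ge0_integralZr//; last 2 first.
  - by apply/measurable_EFinP; exact: measurable_mvnormal_pdf.
  - by move=> x _; rewrite lee_fin mvnormal_pdf_ge0.
  by rewrite integral_mvnormal_pdf1 mul1e.
apply: eq_integral => x _;
rewrite /M (ge0_integral_cV_shift (B *m x)%R mS) => [|y];
  last by rewrite lee_fin mvnormal_pdf_ge0.
transitivity (\int[lebesgue_cV n]_v
    ((mvnormal_pdf 1%:M x)%:E * (mvnormal_pdf S (B *m x + v))%:E)).
  rewrite ge0_integralZl//.
  - apply/measurable_EFinP; apply: measurable_mvnormal_pdf.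
    exact: measurable_addmx.
  - by move=> y _; rewrite lee_fin mvnormal_pdf_ge0.
  - by rewrite lee_fin mvnormal_pdf_ge0.
by apply: eq_integral => v _; rewrite /H/= EFinM addrC.
Qed.

End gaussian_convolution.

(** * Marginals of the skew-normal density *)

Section cfusn.
Context {R : realType}.
Local Open Scope ereal_scope.

Definition le_cV n (u c : 'cV[R]_n) : bool :=
  [forall i, (u i ord0 <= c i ord0)%R].

Lemma le_cV_add2l n (w u c : 'cV[R]_n) : le_cV (w + u) (w + c) = le_cV u c.
Proof. by apply: eq_forallb => i; rewrite !mxE lerD2l. Qed.

Lemma measurable_le_cV d (T : measurableType d) n (u c : T -> 'cV[R]_n) :
  measurable_fun setT u -> measurable_fun setT c ->
  measurable_fun setT (fun t => le_cV (u t) (c t)).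
Proof.
move=> mu mc; apply: measurable_forall => i.
by apply: measurable_fun_ler; exact: measurable_cV_coord.
Qed.

(** [mvnormal_cdf] is a real-valued integral, equal to 0 when the extended one
is infinite; finiteness of the mass makes the two agree. *)
Lemma mvnormal_cdfE n (S : 'M[R]_n) c :
  \int[lebesgue_cV n]_u (mvnormal_pdf S u)%:E = 1 ->
  (mvnormal_cdf S c)%:E =
  \int[lebesgue_cV n]_u (if le_cV u c then (mvnormal_pdf S u)%:E else 0).
Proof.
move=> S1; rewrite /mvnormal_cdf /Rintegral.
set I := RHS; have -> : (\int[lebesgue_cV n]_(u in
    [set u : 'cV[R]_n | forall i, (u i ord0 <= c i ord0)%R])
    (mvnormal_pdf S u)%:E = I).
  rewrite integral_mkcond; apply: eq_integral => u _; rewrite patchE.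
  congr (if _ then _ else _); apply/idP/forallP; first by rewrite inE.
  by move=> uc; rewrite inE.
have mS : measurable_fun setT (fun u => (mvnormal_pdf S u)%:E).
  by apply/measurable_EFinP; exact: measurable_mvnormal_pdf.
rewrite fineK// ge0_fin_numE; last first.
  apply: integral_ge0 => u _; case: ifP => _ //.
  by rewrite lee_fin mvnormal_pdf_ge0.
rewrite (@le_lt_trans _ _ 1) ?ltry// -S1; apply: ge0_le_integral => //.
- by move=> u _; case: ifP => _ //; rewrite lee_fin mvnormal_pdf_ge0.
- by apply: measurable_fun_ifT => //; exact: measurable_le_cV.
- by move=> u _; case: ifP => _ //; rewrite lee_fin mvnormal_pdf_ge0.
Qed.

Lemma mvnormal_cdf_ge0 n (S : 'M[R]_n) c : (0 <= mvnormal_cdf S c)%R.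
Proof.
apply: fine_ge0; apply: integral_ge0 => u _.
by rewrite lee_fin mvnormal_pdf_ge0.
Qed.

Lemma measurable_mvnormal_cdf d (T : measurableType d) n (S : 'M[R]_n)
    (c : T -> 'cV[R]_n) :
  \int[lebesgue_cV n]_u (mvnormal_pdf S u)%:E = 1 ->
  measurable_fun setT c -> measurable_fun setT (fun t => mvnormal_cdf S (c t)).
Proof.
move=> S1 mc; apply/measurable_EFinP => /=.
rewrite (_ : _ \o _ = fun t => \int[lebesgue_cV n]_u
    (if le_cV u (c t) then (mvnormal_pdf S u)%:E else 0)); last first.
  by apply/funext => t; rewrite /= mvnormal_cdfE.
apply: (@measurable_integral_cV _ _ _ _
  (fun t u => if le_cV u (c t) then (mvnormal_pdf S u)%:E else 0)).
- apply: measurable_fun_ifT => //.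
    apply: measurable_le_cV; first exact: measurable_snd.
    by apply: (measurableT_comp mc); exact: measurable_fst.
  apply/measurable_EFinP; apply: measurable_mvnormal_pdf; exact: measurable_snd.
- by move=> t u; case: ifP => _ //; rewrite lee_fin mvnormal_pdf_ge0.
Qed.

(** The translation [u = B x + v] turns [u <= c + B x] into [v <= c], after which
the integral over [x] is the convolution of densities. *)
Lemma integral_mvnormal_cdf_conv k n (S : 'M[R]_n) (B : 'M[R]_(n, k)) c :
  posdef S ->
  \int[lebesgue_cV n]_u (mvnormal_pdf S u)%:E = 1 ->
  \int[lebesgue_cV n]_u (mvnormal_pdf (S + B *m B^T) u)%:E = 1 ->
  \int[lebesgue_cV k]_x
    (mvnormal_pdf 1%:M x * mvnormal_cdf S (c + B *m x))%:E =
  (mvnormal_cdf (S + B *m B^T) c)%:E.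
Proof.
move=> S0 S1 S'1; pose H (p : 'cV[R]_k * 'cV[R]_n) :=
  if le_cV p.2 c then
    (mvnormal_pdf 1%:M p.1 * mvnormal_pdf S (p.2 + B *m p.1))%:E else 0.
have mH : measurable_fun setT H.
  apply: measurable_fun_ifT => //.
    by apply: measurable_le_cV => //; exact: measurable_snd.
  apply: measurable_mvnormal_pdf2; first exact: measurable_fst.
  apply: measurable_addmx; first exact: measurable_snd.
  by apply: measurable_mulmx; exact: measurable_fst.
have H0 p : 0 <= H p by rewrite /H; case: ifP => _ //; exact: mvnormal_pdf2_ge0.
transitivity (\int[lebesgue_cV k]_x \int[lebesgue_cV n]_v H (x, v)).
  apply: eq_integral => x _; rewrite EFinM mvnormal_cdfE//.
  have mS : measurable_fun setT (fun u => if le_cV u (c + B *m x)%R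
      then (mvnormal_pdf S u)%:E else 0).
    apply: measurable_fun_ifT => //; first exact: measurable_le_cV.
    by apply/measurable_EFinP; exact: measurable_mvnormal_pdf.
  have S_ge0 u :
      0 <= (if le_cV u (c + B *m x)%R then (mvnormal_pdf S u)%:E else 0).
    by case: ifP => _ //; rewrite lee_fin mvnormal_pdf_ge0.
  rewrite (ge0_integral_cV_shift (B *m x)%R mS S_ge0).
  have mSB : measurable_fun setT (fun v =>
      if le_cV (B *m x + v)%R (c + B *m x)%R then (mvnormal_pdf S (B *m x + v))%:E else 0).
    by apply: (measurableT_comp mS); exact: measurable_addmx.
  rewrite -ge0_integralZl//; last by rewrite lee_fin mvnormal_pdf_ge0.
  apply: eq_integral => v _; rewrite /H/= [(c + _)%R]addrC le_cV_add2l.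
  by case: ifP => _; rewrite ?mule0// EFinM addrC.
transitivity (\int[lebesgue_cV n]_v \int[lebesgue_cV k]_x H (x, v)).
  exact: fubini_tonelli.
rewrite mvnormal_cdfE//; apply: eq_integral => v _.
rewrite /H/=; case: ifP => _; last exact: integral0.
by rewrite integral_mvnormal_pdf_conv.
Qed.

(** [x' (I - D'D) x] is [|x|^2 - |D x|^2]; normalizing [x] reduces its positivity
to the condition on unit vectors. *)
Lemma skewness_posdef n m (D : 'M[R]_(n, m)) :
  skewness_matrix D -> posdef (1%:M - D^T *m D).
Proof.
move=> sD; split; first by rewrite linearB/= trmx1 trmx_mul trmxK.
have qE k (y : 'cV[R]_k) : ((y^T *m y) ord0 ord0 = \sum_i y i ord0 ^+ 2)%R.
  by rewrite mxE; apply: eq_bigr => i _; rewrite mxE expr2.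
have sum_ge0 k (y : 'cV[R]_k) : (0 <= \sum_i y i ord0 ^+ 2)%R.
  by apply: sumr_ge0 => i _; rewrite sqr_ge0.
have sumZ k (a : R) (y : 'cV[R]_k) :
    (\sum_i (a *: y) i ord0 ^+ 2 = a ^+ 2 * \sum_i y i ord0 ^+ 2)%R.
  by rewrite mulr_sumr; apply: eq_bigr => i _; rewrite mxE exprMn.
move=> x x0.
have s0 : (0 < \sum_i x i ord0 ^+ 2)%R.
  rewrite lt_neqAle sum_ge0 andbT eq_sym; apply: contra x0.
  rewrite psumr_eq0 => [/allP x0|i _]; last exact: sqr_ge0.
  apply/eqP/colP => i; rewrite mxE; apply/eqP; rewrite -sqrf_eq0.
  by apply: x0; rewrite mem_index_enum.
have e0 : (0 < enorm x)%R by rewrite sqrtr_gt0.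
have e2 : (enorm x ^+ 2 = \sum_i x i ord0 ^+ 2)%R by rewrite sqr_sqrtr// ltW.
have := sD ((enorm x)^-1 *: x)%R.
rewrite /enorm sumZ -/(enorm x) exprVn e2 mulVf ?gt_eqF// sqrtr1 => /(_ erefl).
rewrite -scalemxAr sumZ exprVn e2 -[X in (_ < X)%R]sqrtr1 ltr_sqrt// mulrC.
rewrite ltr_pdivrMr// mul1r => lt.
by rewrite /qform mulmxBr mulmx1 mulmxBl mxE [X in (_ + X)%R]mxE qE
  mulmxA -trmx_mul -mulmxA qE subr_gt0.
Qed.

Lemma cfusn_pdf_ge0 n m (E : 'M[R]_(n, m)) z : (0 <= cfusn_pdf E z)%R.
Proof.
by rewrite mulr_ge0 ?mvnormal_cdf_ge0// mulr_ge0 ?mvnormal_pdf_ge0 ?exprn_ge0.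
Qed.

Section marginals.
Variables (n1 n2 m : nat) (D : 'M[R]_(n1 + n2, m)).
Hypothesis sD : skewness_matrix D.
Let D1 := usubmx D.
Let D2 := dsubmx D.
Let S := (1%:M - D^T *m D)%R.
Let S1 := (1%:M - D1^T *m D1)%R.
Let S2 := (1%:M - D2^T *m D2)%R.

Lemma gram_split : (D^T *m D = D1^T *m D1 + D2^T *m D2)%R.
Proof. by rewrite -[in LHS](vsubmxK D) tr_col_mx mul_row_col. Qed.

(** The covariance attached to a block is [S] plus the Gram matrix of the other
block, as [D'D] is the sum of the two Gram matrices. *)
Lemma cov_usubmx : S1 = (S + D2^T *m D2^T^T)%R.
Proof. by rewrite /S gram_split trmxK opprD addrA subrK. Qed.

Lemma cov_dsubmx : S2 = (S + D1^T *m D1^T^T)%R.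
Proof. by rewrite /S gram_split trmxK opprD addrA addrAC subrK. Qed.

Lemma integral_cov : \int[lebesgue_cV m]_u (mvnormal_pdf S u)%:E = 1.
Proof.
apply: (@integral_mvnormal_pdf _ _ _ _ D^T); first exact: skewness_posdef.
by rewrite trmxK subrK.
Qed.

Lemma integral_cov_usubmx : \int[lebesgue_cV m]_u (mvnormal_pdf S1 u)%:E = 1.
Proof.
apply: (@integral_mvnormal_pdf _ _ _ _ D1^T); last by rewrite trmxK subrK.
by rewrite cov_usubmx; apply: posdef_add_gram; exact: skewness_posdef.
Qed.

Lemma integral_cov_dsubmx : \int[lebesgue_cV m]_u (mvnormal_pdf S2 u)%:E = 1.
Proof.
apply: (@integral_mvnormal_pdf _ _ _ _ D2^T); last by rewrite trmxK subrK.
by rewrite cov_dsubmx; apply: posdef_add_gram; exact: skewness_posdef.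
Qed.

Lemma tr_mul_col_mx (x : 'cV[R]_n1) (y : 'cV[R]_n2) :
  (D^T *m col_mx x y = D1^T *m x + D2^T *m y)%R.
Proof. by rewrite -[in LHS](vsubmxK D) tr_col_mx mul_row_col. Qed.

(** Both marginals at once: [E] is the block that is kept and [F] the one that
is integrated out. *)
Lemma cfusn_pdf_marginal k j (E : 'M[R]_(k, m)) (F : 'M[R]_(j, m))
    (x : 'cV[R]_k) :
  (1%:M - E^T *m E = S + F^T *m F^T^T)%R ->
  \int[lebesgue_cV m]_u (mvnormal_pdf (1%:M - E^T *m E) u)%:E = 1 ->
  \int[lebesgue_cV j]_y (2 ^+ m * (mvnormal_pdf 1%:M x * mvnormal_pdf 1%:M y) *
    mvnormal_cdf S (E^T *m x + F^T *m y))%:E =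
  (cfusn_pdf E x)%:E.
Proof.
move=> EF E1; have S0 : posdef S by exact: skewness_posdef.
have conv := @integral_mvnormal_cdf_conv j m S F^T (E^T *m x) S0 integral_cov.
rewrite -EF in conv.
rewrite /cfusn_pdf [RHS]EFinM -(conv E1).
transitivity (\int[lebesgue_cV j]_y ((2 ^+ m * mvnormal_pdf 1%:M x)%:E *
  (mvnormal_pdf 1%:M y * mvnormal_cdf S (E^T *m x + F^T *m y))%:E)).
  by apply: eq_integral => y _; rewrite -EFinM; congr EFin; ring.
rewrite ge0_integralZl//.
- apply/measurable_EFinP; apply: measurable_funM.
    exact: measurable_mvnormal_pdf.
  apply: measurable_mvnormal_cdf; first exact: integral_cov.
  by apply: measurable_addmx => //; exact: measurable_mulmx.
- by move=> y _; rewrite lee_fin mulr_ge0 ?mvnormal_cdf_ge0 ?mvnormal_pdf_ge0.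
- by rewrite lee_fin mulr_ge0 ?mvnormal_pdf_ge0 ?exprn_ge0.
Qed.

Lemma cfusn_pdf_usubmx x :
  \int[lebesgue_cV n2]_y (cfusn_pdf D (col_mx x y))%:E = (cfusn_pdf D1 x)%:E.
Proof.
apply: etrans
  (@cfusn_pdf_marginal n1 n2 D1 D2 x cov_usubmx integral_cov_usubmx).
apply: eq_integral => y _.
by rewrite /cfusn_pdf mvnormal_pdf1_col_mx tr_mul_col_mx.
Qed.

Lemma cfusn_pdf_dsubmx y :
  \int[lebesgue_cV n1]_x (cfusn_pdf D (col_mx x y))%:E = (cfusn_pdf D2 y)%:E.
Proof.
apply: etrans
  (@cfusn_pdf_marginal n2 n1 D2 D1 y cov_dsubmx integral_cov_dsubmx).
apply: eq_integral => x _.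
rewrite /cfusn_pdf mvnormal_pdf1_col_mx tr_mul_col_mx.
by rewrite [(D2^T *m _ + _)%R]addrC [(mvnormal_pdf _ y * _)%R]mulrC.
Qed.

End marginals.
End cfusn.

(** * Densities of random vectors *)

Section densities.
Context {R : realType} {d : measure_display} {Omega : measurableType d}.
Variable P : probability Omega R.
Local Open Scope ereal_scope.

(** Inversion is expressed through [ln] and [expR], according to the sign. *)
Lemma measurable_inv d' (T : measurableType d') (f : T -> R) :
  measurable_fun setT f -> measurable_fun setT (fun t => (f t)^-1%R).
Proof.
move=> mf; apply: (measurableT_comp _ mf).
rewrite (_ : GRing.inv = fun x : R => if (0 < x)%R then expR (- ln x) else
    if (x < 0)%R then (- expR (- ln (- x)))%R else 0%R); last first.
  apply/funext => x; case: (ltgtP 0%R x) => [x0|x0|<-]; last by rewrite invr0.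
    by rewrite expRN lnK.
  by rewrite expRN lnK ?posrE ?oppr_gt0// invrN opprK.
apply: measurable_fun_ifT; first exact: measurable_fun_ltr.
  apply: measurableT_comp => //; apply: measurable_funN; exact: measurable_ln.
apply: measurable_fun_ifT => //; first exact: measurable_fun_ltr.
apply: measurable_funN; apply: measurableT_comp => //; apply: measurable_funN.
by apply: measurableT_comp => //; exact: measurable_ln.
Qed.

(** Two densities differ only on a Lebesgue-null set, and the law of [X] does not
charge such a set. *)
Lemma has_density_unique n (X : Omega -> 'cV[R]_n) f g :
  has_density P X f -> has_density P X g ->
  {ae P, forall w, f (X w) = g (X w)}.
Proof.
move=> [mX mf f0 Pf] [_ mg g0 Pg].
have mfE : measurable_fun setT (EFin \o f) by exact/measurable_EFinP.
have intf : (lebesgue_cV n).-integrable setT (EFin \o f).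
  apply/integrableP; split => //.
  under eq_integral do rewrite /= ger0_norm//.
  by rewrite -Pf// preimage_setT probability_setT ltry.
have : ae_eq (lebesgue_cV n) setT (EFin \o f) (EFin \o g).
  apply: integral_ae_eq => //; first exact/measurable_EFinP.
  by move=> A _ mA; rewrite -Pf// -Pg.
move=> [N [mN N0 fgN]]; exists (X @^-1` N); split.
- by rewrite -[X in measurable X]setTI; exact: mX.
- rewrite Pf//; apply: null_set_integral => //; exact: measurable_funTS.
- move=> w /= fgw; apply: fgN => /= fg; apply: fgw.
  by have [] := fg Logic.I.
Qed.

Lemma has_density_usubmx n1 n2 (X : Omega -> 'cV[R]_(n1 + n2)) f
    (g : 'cV[R]_n1 -> R) :
  has_density P X f -> measurable_fun setT g -> (forall x, 0 <= g x)%R ->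
  (forall x, \int[lebesgue_cV n2]_y (f (col_mx x y))%:E = (g x)%:E) ->
  has_density P (usubmx \o X) g.
Proof.
move=> [mX mf f0 Pf] mg g0 fg; split => //; first exact: measurable_usubmx.
move=> A mA; have mpA : measurable (@usubmx R n1 n2 1 @^-1` A).
  by rewrite -[X in measurable X]setTI; exact: measurable_usubmx.
rewrite comp_preimage Pf// [LHS]integral_mkcond [RHS]integral_mkcond.
have mfE : measurable_fun setT (EFin \o f) by exact/measurable_EFinP.
rewrite ge0_integral_col_mx; last 2 first.
- by apply/(measurable_restrictT _ _).1 => //; exact: measurable_funTS.
- by move=> z; apply: erestrict_ge0 => t _; rewrite lee_fin.
apply: eq_integral => x _; rewrite patchE; case: ifPn => xA.
  rewrite -fg; apply: eq_integral => y _.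
  by rewrite patchE ifT// inE/= col_mxKu -inE.
apply: integral0_eq => y _; rewrite patchE ifF//; apply: contraNF xA.
by rewrite !inE/= col_mxKu.
Qed.

Lemma has_density_dsubmx n1 n2 (X : Omega -> 'cV[R]_(n1 + n2)) f
    (g : 'cV[R]_n2 -> R) :
  has_density P X f -> measurable_fun setT g -> (forall x, 0 <= g x)%R ->
  (forall y, \int[lebesgue_cV n1]_x (f (col_mx x y))%:E = (g y)%:E) ->
  has_density P (dsubmx \o X) g.
Proof.
move=> [mX mf f0 Pf] mg g0 fg; split => //; first exact: measurable_dsubmx.
move=> A mA; have mpA : measurable (@dsubmx R n1 n2 1 @^-1` A).
  by rewrite -[X in measurable X]setTI; exact: measurable_dsubmx.
rewrite comp_preimage Pf// [LHS]integral_mkcond [RHS]integral_mkcond.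
have mfE : measurable_fun setT (EFin \o f) by exact/measurable_EFinP.
set h := _ \_ _; have mh : measurable_fun setT h.
  by apply/(measurable_restrictT _ _).1 => //; exact: measurable_funTS.
have h0 z : 0 <= h z by apply: erestrict_ge0 => t _; rewrite lee_fin.
rewrite ge0_integral_col_mx//.
transitivity (\int[lebesgue_cV n2]_y \int[lebesgue_cV n1]_x h (col_mx x y)).
  apply: (@fubini_tonelli _ _ _ _ _ _ _ (fun p => h (col_mx p.1 p.2))) => //.
  by apply: (measurableT_comp mh); apply: measurable_col_mx;
    [exact: measurable_fst|exact: measurable_snd].
apply: eq_integral => y _; rewrite [RHS]patchE; case: ifPn => yA.
  rewrite -fg; apply: eq_integral => x _.
  by rewrite /h patchE ifT// inE/= col_mxKd -inE.
apply: integral0_eq => x _; rewrite /h patchE ifF//; apply: contraNF yA.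
by rewrite !inE/= col_mxKd.
Qed.

(** Almost surely [Y w] lies in [A] iff [ln (Y w)] lies in the preimage of [A]
under the exponential; the substitution [y = exp t] then produces the inverse
Jacobian factor. *)
Lemma has_density_ln_cV n (Y : Omega -> 'cV[R]_n) f :
  measurable_fun setT Y ->
  {ae P, forall w, forall i, (0 < Y w i ord0)%R} ->
  has_density P (ln_cV \o Y) f ->
  has_density P Y (fun y =>
    if pos_cV y then ((\prod_i y i ord0)^-1 * f (ln_cV y))%R else 0%R).
Proof.
move=> mY Y0 [mlnY mf f0 Pf].
have mln : measurable_fun setT (@ln_cV R n).
  by apply: measurable_map_cV => //; exact: measurable_ln.
have mprod : measurable_fun setT (fun y : 'cV[R]_n => \prod_i y i ord0)%R.
  by apply: measurable_prod => i _; exact: measurable_coord.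
set g := fun y => _.
have g0 y : (0 <= g y)%R.
  rewrite /g; case: ifP => // /forallP y0; rewrite mulr_ge0// invr_ge0.
  by apply: prodr_ge0 => i _; exact/ltW.
have mg : measurable_fun setT g.
  apply: measurable_fun_ifT => //; first exact: measurable_pos_cV.
  apply: measurable_funM; first exact: measurable_inv.
  exact: measurableT_comp.
split => // A mA.
have mexp : measurable_fun setT (@exp_cV R n) by exact: measurable_map_cV.
have expK (t : 'cV[R]_n) : ln_cV (exp_cV t) = t.
  by apply/colP => i; rewrite !mxE expRK.
have lnK' (y : 'cV[R]_n) : pos_cV y -> exp_cV (ln_cV y) = y.
  by move=> /forallP y0; apply/colP => i; rewrite !mxE lnK// posrE.
have mEA : measurable (@exp_cV R n @^-1` A).
  by rewrite -[X in measurable X]setTI; exact: mexp.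
have mYA : measurable (Y @^-1` A).
  by rewrite -[X in measurable X]setTI; exact: mY.
have mlnYA : measurable ((ln_cV \o Y) @^-1` (@exp_cV R n @^-1` A)).
  by rewrite -[X in measurable X]setTI; exact: mlnY.
transitivity (P ((ln_cV \o Y) @^-1` (@exp_cV R n @^-1` A))).
  rewrite -[Y @^-1` A]setIT -[(_ \o Y) @^-1` _]setIT -!integral_indic//.
  apply: ae_eq_integral => //.
  - exact/measurable_EFinP/measurable_indic.
  - exact/measurable_EFinP/measurable_indic.
  apply: filterS Y0 => w Yw _; rewrite /= !indicE; congr (_%:R)%:E.
  have /lnK' Yw' : pos_cV (Y w) by exact/forallP.
  by congr nat_of_bool; apply/idP/idP; rewrite !inE/= Yw'.
rewrite Pf// [LHS]integral_mkcond [RHS]integral_mkcond.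
set G := _ \_ A.
have mG : measurable_fun setT G.
  apply/(measurable_restrictT _ _).1 => //.
  exact/measurable_EFinP/measurable_funTS.
have G0 y : 0 <= G y by apply: erestrict_ge0 => t _; rewrite lee_fin.
have -> : \int[lebesgue_cV n]_y G y =
    \int[lebesgue_cV n]_y (if pos_cV y then G y else 0).
  apply: eq_integral => y _; case: ifPn => // y0.
  by rewrite /G patchE /g (negbTE y0); case: ifP.
rewrite ge0_integral_cV_expR//; apply: eq_integral => t _.
have t0 : pos_cV (exp_cV t) by apply/forallP => i; rewrite mxE expR_gt0.
have -> : (\prod_i expR (t i ord0) = \prod_i exp_cV t i ord0)%R.
  by apply: eq_bigr => i _; rewrite mxE.
have p0 : (0 < \prod_i exp_cV t i ord0)%R.
  by apply: prodr_gt0 => i _; rewrite mxE expR_gt0.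
rewrite /G !patchE (_ : (t \in _) = (exp_cV t \in A)); last first.
  by apply/idP/idP; rewrite !inE.
case: ifP => _; last by rewrite mul0e.
by rewrite /g t0 expK -EFinM mulrAC mulVf ?gt_eqF// mul1r.
Qed.

End densities.

(** * The likelihood ratio of the joint law and the marginals *)

Section mutual_information_cfusn.
Context {R : realType} {d : measure_display} {Omega : measurableType d}.
Variable P : probability Omega R.
Variables (n1 n2 m : nat) (D : 'M[R]_(n1 + n2, m)).
Hypothesis sD : skewness_matrix D.
Local Notation D1 := (usubmx D).
Local Notation D2 := (dsubmx D).

Lemma measurable_cfusn_pdf n (E : 'M[R]_(n, m)) :
  (\int[lebesgue_cV m]_u (mvnormal_pdf (1%:M - E^T *m E) u)%:E = 1)%E ->
  measurable_fun setT (cfusn_pdf E).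
Proof.
move=> E1; apply: measurable_funM.
  by apply: measurable_funM => //; exact: measurable_mvnormal_pdf.
by apply: measurable_mvnormal_cdf => //; exact: measurable_mulmx.
Qed.

Lemma CFUSN_usubmx (Z : Omega -> 'cV[R]_(n1 + n2)) :
  CFUSN P D Z -> CFUSN P D1 (usubmx \o Z).
Proof.
move=> ZD; apply: (has_density_usubmx ZD).
- by apply: measurable_cfusn_pdf; exact: integral_cov_usubmx.
- by move=> x; exact: cfusn_pdf_ge0.
- by move=> x; exact: cfusn_pdf_usubmx.
Qed.

Lemma CFUSN_dsubmx (Z : Omega -> 'cV[R]_(n1 + n2)) :
  CFUSN P D Z -> CFUSN P D2 (dsubmx \o Z).
Proof.
move=> ZD; apply: (has_density_dsubmx ZD).
- by apply: measurable_cfusn_pdf; exact: integral_cov_dsubmx.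
- by move=> x; exact: cfusn_pdf_ge0.
- by move=> x; exact: cfusn_pdf_dsubmx.
Qed.

Lemma cancel_common_factors (F : fieldType) (a b e p q G G1 G2 : F) :
  a != 0 -> b != 0 -> e != 0 -> p != 0 -> q != 0 ->
  a * b * (e * (p * q) * G) / (a * (e * p * G1) * (b * (e * q * G2))) =
  G / (e * G1 * G2).
Proof.
move=> a0 b0 e0 p0 q0.
(* The inverse of 0 is 0, so the identity also holds when G1 or G2 vanishes. *)
rewrite !invfM; move: (G1^-1) (G2^-1) => H1 H2.
by field; rewrite a0 b0 e0 p0 q0.
Qed.

Definition cdf_ratio (t : 'cV[R]_(n1 + n2)) : R :=
  mvnormal_cdf (1%:M - D^T *m D) (D^T *m t) /
    (2 ^+ m * mvnormal_cdf (1%:M - D1^T *m D1) (D1^T *m usubmx t)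
            * mvnormal_cdf (1%:M - D2^T *m D2) (D2^T *m dsubmx t)).

(** [a] and [b] stand for the Jacobian factors of the two blocks. *)
Lemma cfusn_pdf_ratio (a b : R) t : a != 0 -> b != 0 ->
  a * b * cfusn_pdf D t /
    (a * cfusn_pdf D1 (usubmx t) * (b * cfusn_pdf D2 (dsubmx t))) =
  cdf_ratio t.
Proof.
move=> a0 b0; rewrite /cfusn_pdf /cdf_ratio.
rewrite -{1}(vsubmxK t) mvnormal_pdf1_col_mx.
have p1 : mvnormal_pdf 1%:M (usubmx t) != 0.
  by rewrite gt_eqF// mvnormal_pdf1_gt0.
have p2 : mvnormal_pdf 1%:M (dsubmx t) != 0.
  by rewrite gt_eqF// mvnormal_pdf1_gt0.
have e0 : (2 ^+ m : R) != 0 by rewrite expf_neq0.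
exact: cancel_common_factors.
Qed.

Lemma measurable_cdf_ratio : measurable_fun setT cdf_ratio.
Proof.
apply: measurable_funM.
  apply: measurable_mvnormal_cdf; first exact: integral_cov.
  exact: measurable_mulmx.
apply: measurable_inv; apply: measurable_funM; first apply: measurable_funM => //.
  apply: measurable_mvnormal_cdf; first exact: integral_cov_usubmx.
  by apply: measurable_mulmx; exact: measurable_usubmx.
apply: measurable_mvnormal_cdf; first exact: integral_cov_dsubmx.
by apply: measurable_mulmx; exact: measurable_dsubmx.
Qed.

(** The part common to both cases: it suffices that almost surely the densities
are those of the skew-normal vector [T] up to a factor for each block. *)
Lemma mutual_information_cdf_ratio (X T : Omega -> 'cV[R]_(n1 + n2))
    (f12 : 'cV[R]_(n1 + n2) -> R) (f1 : 'cV[R]_n1 -> R) (f2 : 'cV[R]_n2 -> R) :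
  measurable_fun setT X -> measurable_fun setT T ->
  measurable_fun setT f12 -> measurable_fun setT f1 -> measurable_fun setT f2 ->
  {ae P, forall w, exists a b : R, [/\ a != 0, b != 0,
    f12 (X w) = a * b * cfusn_pdf D (T w),
    f1 (usubmx (X w)) = a * cfusn_pdf D1 (usubmx (T w)) &
    f2 (dsubmx (X w)) = b * cfusn_pdf D2 (dsubmx (T w))]} ->
  mutual_information P (usubmx \o X) (dsubmx \o X) f12 f1 f2 =
  ('E_P[fun w => ln (cdf_ratio (T w))])%E.
Proof.
move=> mX mT mf12 mf1 mf2 fE.
have mln (g : Omega -> R) :
    measurable_fun setT g -> measurable_fun setT (fun w => ln (g w)).
  by move=> mg; apply: (measurableT_comp _ mg); exact: measurable_ln.
rewrite /mutual_information unlock.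
apply: ae_eq_integral => //.
- apply/measurable_EFinP; apply: mln.
  apply: measurable_funM.
    by apply: (measurableT_comp mf12); apply: measurable_col_mx;
      [exact: measurable_usubmx|exact: measurable_dsubmx].
  apply: measurable_inv; apply: measurable_funM.
    by apply: (measurableT_comp mf1); exact: measurable_usubmx.
  by apply: (measurableT_comp mf2); exact: measurable_dsubmx.
- apply/measurable_EFinP; apply: mln.
  exact: (measurableT_comp measurable_cdf_ratio).
- apply: filterS fE => w [a [b [a0 b0 e12 e1 e2]]] _ /=.
  by rewrite vsubmxK e12 e1 e2 cfusn_pdf_ratio.
Qed.

Lemma CFUSN_densityE (X : Omega -> 'cV[R]_(n1 + n2)) f12 f1 f2 :
  CFUSN P D X -> has_density P X f12 ->
  has_density P (usubmx \o X) f1 -> has_density P (dsubmx \o X) f2 ->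
  {ae P, forall w, exists a b : R, [/\ a != 0, b != 0,
    f12 (X w) = a * b * cfusn_pdf D (X w),
    f1 (usubmx (X w)) = a * cfusn_pdf D1 (usubmx (X w)) &
    f2 (dsubmx (X w)) = b * cfusn_pdf D2 (dsubmx (X w))]}.
Proof.
move=> XD d12 d1 d2.
have := has_density_unique d12 XD.
have := has_density_unique d1 (CFUSN_usubmx XD).
have := has_density_unique d2 (CFUSN_dsubmx XD).
apply: filterS3 => w e2 e1 e12; exists 1, 1.
split; [exact: oner_neq0|exact: oner_neq0| | |].
- by rewrite mulr1 mul1r; exact: e12.
- by rewrite mul1r; exact: e1.
- by rewrite mul1r; exact: e2.
Qed.

(** Logarithms and blocks commute, so that the marginals of [X] are again
log-skew-normal, and the Jacobian factor of [X] is the product of those of its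
blocks. *)
Lemma LCFUSN_densityE (X : Omega -> 'cV[R]_(n1 + n2)) f12 f1 f2 :
  measurable_fun setT X ->
  LCFUSN P D X -> has_density P X f12 ->
  has_density P (usubmx \o X) f1 -> has_density P (dsubmx \o X) f2 ->
  {ae P, forall w, exists a b : R, [/\ a != 0, b != 0,
    f12 (X w) = a * b * cfusn_pdf D (ln_cV (X w)),
    f1 (usubmx (X w)) = a * cfusn_pdf D1 (usubmx (ln_cV (X w))) &
    f2 (dsubmx (X w)) = b * cfusn_pdf D2 (dsubmx (ln_cV (X w)))]}.
Proof.
move=> mX [X0 XD] d12 d1 d2.
have lnu (x : 'cV[R]_(n1 + n2)) : ln_cV (usubmx x) = usubmx (ln_cV x).
  by apply/colP => i; rewrite !mxE.
have lnd (x : 'cV[R]_(n1 + n2)) : ln_cV (dsubmx x) = dsubmx (ln_cV x).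
  by apply/colP => i; rewrite !mxE.
have XD1 : CFUSN P D1 (ln_cV \o (usubmx \o X)).
  rewrite (_ : _ \o _ = usubmx \o (ln_cV \o X)); first exact: CFUSN_usubmx.
  by apply/funext => w /=; rewrite lnu.
have XD2 : CFUSN P D2 (ln_cV \o (dsubmx \o X)).
  rewrite (_ : _ \o _ = dsubmx \o (ln_cV \o X)); first exact: CFUSN_dsubmx.
  by apply/funext => w /=; rewrite lnd.
have X1 : {ae P, forall w, forall i, 0 < (usubmx \o X) w i ord0}.
  by apply: filterS X0 => w Xw i; rewrite mxE.
have X2 : {ae P, forall w, forall i, 0 < (dsubmx \o X) w i ord0}.
  by apply: filterS X0 => w Xw i; rewrite mxE.
have e12 := has_density_unique d12 (has_density_ln_cV mX X0 XD).
have e1 := has_density_unique d1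
  (has_density_ln_cV (measurable_usubmx mX) X1 XD1).
have e2 := has_density_unique d2
  (has_density_ln_cV (measurable_dsubmx mX) X2 XD2).
apply: filterS2 X0 (filterS3 _ (fun _ a b c => conj a (conj b c)) e12 e1 e2).
move=> w Xw [{}e12 [{}e1 {}e2]].
have p1 : pos_cV (usubmx (X w)) by apply/forallP => i; rewrite mxE.
have p2 : pos_cV (dsubmx (X w)) by apply/forallP => i; rewrite mxE.
have p12 : pos_cV (X w) by exact/forallP.
exists (\prod_i usubmx (X w) i ord0)^-1, (\prod_i dsubmx (X w) i ord0)^-1.
split.
- by rewrite invr_eq0 gt_eqF//; apply: prodr_gt0 => i _; exact: (forallP p1).
- by rewrite invr_eq0 gt_eqF//; apply: prodr_gt0 => i _; exact: (forallP p2).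
- rewrite e12 p12 -invfM; congr (_^-1 * _); rewrite big_split_ord/=.
  by congr (_ * _); apply: eq_bigr => i _; rewrite mxE.
- by move: e1; rewrite /= p1 lnu; exact: id.
- by move: e2; rewrite /= p2 lnd; exact: id.
Qed.

End mutual_information_cfusn.

Unset Implicit Arguments.
Set Strict Implicit.
Set Printing Implicit Defensive.

Theorem mainTheorem5 (R : realType) (d : measure_display)
  (Omega : measurableType d) (P : probability Omega R)
  (n1 n2 m : nat) (n1_gt0 : (0 < n1)%N) (n2_gt0 : (0 < n2)%N)
  (m_gt0 : (0 < m)%N)
  (D : 'M[R]_(n1 + n2, m)) (D_skew : skewness_matrix D)
  (X : {RV P >-> 'cV[R]_(n1 + n2)}) (T : Omega -> 'cV[R]_(n1 + n2))
  (X_law : (CFUSN P D X /\ T = X) \/ (LCFUSN P D X /\ T = ln_cV \o X))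
  (f12 : 'cV[R]_(n1 + n2) -> R) (f1 : 'cV[R]_n1 -> R) (f2 : 'cV[R]_n2 -> R)
  (f12_density : has_density P X f12)
  (f1_density : has_density P (usubmx \o X) f1)
  (f2_density : has_density P (dsubmx \o X) f2) :
  let D1 := usubmx D in
  let D2 := dsubmx D in
  let T1 w := usubmx (T w) in
  let T2 w := dsubmx (T w) in
  mutual_information P (usubmx \o X) (dsubmx \o X) f12 f1 f2 =
  'E_P[fun w => ln (mvnormal_cdf (1%:M - D^T *m D) (D^T *m T w) /
    (2 ^+ m * mvnormal_cdf (1%:M - D1^T *m D1) (D1^T *m T1 w)
            * mvnormal_cdf (1%:M - D2^T *m D2) (D2^T *m T2 w)))]%E.
Proof.
move=> D1 D2 T1 T2.
have [mX mf12 _ _] := f12_density.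
have [_ mf1 _ _] := f1_density.
have [_ mf2 _ _] := f2_density.
have ratio T' := @mutual_information_cdf_ratio R d Omega P n1 n2 m D D_skew
  X T' f12 f1 f2 mX.
case: X_law => -[XD TE]; rewrite /T1 /T2 /D1 /D2 TE.
- exact: ratio mX mf12 mf1 mf2
    (CFUSN_densityE D_skew XD f12_density f1_density f2_density).
- have [_ [mlnX _ _ _]] := XD.
  exact: ratio mlnX mf12 mf1 mf2
    (LCFUSN_densityE D_skew mX XD f12_density f1_density f2_density).
Qed.
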